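(* For every complex-valued Borel simple function $\phi$ on $(-1,1)$, $$\left(\int_0^\infty\frac{4\lambda}{e^{\pi\lambda}+1}\,d\lambda\right)^{1/2}\|\phi\|_2\le\sup_{|\theta|=1}\|T_2(\theta\phi)\|_2,$$ where the supremum is over all $\theta\in L^\infty(-1,1)$ with $|\theta|=1$ a.e.
   Context: $\|\cdot\|_2$ is the norm of $L^2(-1,1)$ with Lebesgue measure. The finite Hilbert transform of $f\in L^1(-1,1)$ is $(Tf)(t)=\lim_{\varepsilon\to0^+}\frac1\pi\big(\int_{-1}^{t-\varepsilon}+\int_{t+\varepsilon}^1\big)\frac{f(x)}{x-t}\,dx$ (exists a.e.); it maps $L^2(-1,1)$ boundedly into itself, and this operator is denoted $T_2$. *)

(* Defs.v *)
From HB Require Import structures.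
From mathcomp Require Import all_boot all_order all_algebra.
From mathcomp Require Import all_classical all_reals all_analysis.
Set Implicit Arguments. Unset Strict Implicit. Unset Printing Implicit Defensive.
Import Order.TTheory GRing.Theory Num.Theory.
Import numFieldNormedType.Exports.
Local Open Scope classical_set_scope.
Local Open Scope ring_scope.

Section Defs.
Variable R : realType.

(* complex-valued functions R -> C, with C = R x R (real part, imaginary part) *)
Definition cfun := R -> R * R.

Definition cmulf (f g : cfun) : cfun := fun x =>
  ((f x).1 * (g x).1 - (f x).2 * (g x).2, (f x).1 * (g x).2 + (f x).2 * (g x).1).

Definition I11 : set R := `]-1, 1[.

Definition cmeasurable (f : cfun) : Prop :=
  measurable_fun I11 (fun x => (f x).1) /\ measurable_fun I11 (fun x => (f x).2).

Definition borel_simple (f : cfun) : Prop :=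
  cmeasurable f /\ finite_set (f @` I11).

Definition L2norm (f : cfun) : \bar R :=
  ((\int[lebesgue_measure]_(x in I11) (((f x).1 ^+ 2 + (f x).2 ^+ 2)%:E))
     `^ (2^-1))%E.

Definition hilbert_trunc (f : R -> R) (t eps : R) : R :=
  pi^-1 * \int[lebesgue_measure]_(x in I11 `\` `[t - eps, t + eps])
            (f x / (x - t)).

Definition hilbertR (f : R -> R) (t : R) : R :=
  lim (hilbert_trunc f t @ 0^'+).

(* finite Hilbert transform of a complex-valued function (the kernel is
   real, so it acts componentwise) *)
Definition hilbert (f : cfun) : cfun := fun t =>
  (hilbertR (fun x => (f x).1) t, hilbertR (fun x => (f x).2) t).

Definition unimodular (th : cfun) : Prop :=
  cmeasurable th /\
  {ae lebesgue_measure, forall x, I11 x -> (th x).1 ^+ 2 + (th x).2 ^+ 2 = 1}.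

End Defs.

(* Main.v *)
(* The constant on the left is at most 8/9 < 1, because pi^2 >= 8 and
   e^u >= 9u/4, so it suffices to find theta = +1 or -1 on the pieces of a
   partition with |T(theta phi)|^2 >= (1 - eps) |phi|^2.

   For bounded f supported in (-1, 1), let P_y, Q_y be its convolutions with
   y / (u^2 + y^2) and u / (u^2 + y^2).  The energy identity
   |P_y|^2 + |Q_y|^2 = 2 pi <f, P_2y> shows that Q_y converges in L^2(R) to some
   g with |g|^2 = pi^2 |f|^2; the identity Q_y * p_s + P_y * q_s = 2 pi Q_(y+s)
   gives g * p_s = pi Q_s, and at Lebesgue points of f and g this identifies g
   with the principal value integral.

   If f lives on an interval of length l at distance d from the endpoints, then
   |Q_y(t)| = O(l / (d |t|)) off (-1, 1), so all but O(l^2) of the energy of g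
   stays in (-1, 1).  Cut phi into N pieces of length O(1/N): the parallelogram
   law lets one choose the signs successively so that the squared norms of the
   transforms at least add up, and the total loss is O(N / N^2).  The part of
   phi near the endpoints contributes an arbitrarily small mass. *)
Require Import Defs.
From HB Require Import structures.
From mathcomp Require Import all_boot all_order all_algebra.
From mathcomp Require Import all_classical all_reals all_analysis.
From mathcomp Require Import measurable_realfun ring lra.
Set Implicit Arguments. Unset Strict Implicit. Unset Printing Implicit Defensive.
Import Order.TTheory GRing.Theory Num.Theory.
Import numFieldNormedType.Exports.
Local Open Scope classical_set_scope.
Local Open Scope ring_scope.

(** All L^2 facts come from explicit integrals of products of the two kernels. The obstacle is that
    u / (u^2 + y^2) is square integrable but not integrable on the line, so functions are tracked
    through a majorant C / (1 + u^2) of their square. This majorant survives translation and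
    averaging over (-1, 1), and it makes products integrable.

    The energy pairing of heights y and w depends only on y + w; squared distances between the Q_y
    are therefore second differences of a convergent function, whence the Cauchy property. The
    factor 1/pi is left out until the end, so g is pi times the transform.

    The transform acts on real and imaginary parts separately and the same sign has to serve both;
    the parallelogram law is therefore applied to the sum of the two energies.

    The constant 8/9 arises by comparing the integrand with 8/9 times the exponential density of
    rate pi/2. The remaining 1/9 pays for every loss. *)

Lemma measurable_funV d (T : measurableType d) (R : realType) (D : set T)
    (f : T -> R) : measurable_fun D f -> measurable_fun D (fun x => (f x)^-1).
Proof.
move=> mf.
(* This form reduces the claim to measurability of the real power. It is also right at zeros of [f],
   where both sides are 0. *)
have -> : (fun x => (f x)^-1) = (fun x => f x * (f x ^+ 2) `^ (-1)).
  apply/funext => x; rewrite powR_inv1 ?sqr_ge0//.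
  have [->|f0] := eqVneq (f x) 0; first by rewrite mul0r invr0.
  by rewrite expr2 invfM mulrA mulfV// mul1r.
apply: measurable_funM => //.
apply: (@measurableT_comp _ _ _ _ _ _ (@powR R ^~ (-1)) _ (fun x => f x ^+ 2)).
  exact: measurable_powR.
exact: measurable_funX.
Qed.

(** * Real-valued integration on the line *)

Section RealIntegral.
Variable R : realType.
Notation mu := (@lebesgue_measure R).
Implicit Types f g : R -> R.

Definition intg f := mu.-integrable setT (EFin \o f).
Definition Int f : R := \int[mu]_x f x.
Definition meas f := measurable_fun [set: R] f.

Lemma intg_meas {f} : intg f -> meas f.
Proof. by move=> /measurable_int/measurable_EFinP. Qed.

Lemma intg_le {f g} : meas f -> intg g -> (forall x, `|f x| <= g x) -> intg f.
Proof.
move=> mf ig fg; apply: (le_integrable measurableT _ _ ig).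
  exact/measurable_EFinP.
move=> x _ /=; rewrite lee_fin; exact: le_trans (fg x) (ler_norm _).
Qed.

Lemma intgD {f g} : intg f -> intg g -> intg (fun x => f x + g x).
Proof. by move=> i1 i2; have := integrableD measurableT i1 i2. Qed.

Lemma intgB {f g} : intg f -> intg g -> intg (fun x => f x - g x).
Proof. by move=> i1 i2; have := integrableB measurableT i1 i2. Qed.

Lemma intgZ {f} c : intg f -> intg (fun x => c * f x).
Proof. by move=> i1; have := integrableZl measurableT c i1. Qed.

Lemma intg_abs {f} : intg f -> intg (fun x => `|f x|).
Proof. by move=> i1; have := integrable_norm i1. Qed.

Lemma intg0 : intg (fun=> 0).
Proof. exact: (@integrable0 _ _ _ mu setT). Qed.

Lemma IntD {f g} : intg f -> intg g -> Int (fun x => f x + g x) = Int f + Int g.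
Proof. by move=> i1 i2; rewrite /Int RintegralD. Qed.

Lemma IntB {f g} : intg f -> intg g -> Int (fun x => f x - g x) = Int f - Int g.
Proof. by move=> i1 i2; rewrite /Int RintegralB. Qed.

Lemma IntZ {f} c : intg f -> Int (fun x => c * f x) = c * Int f.
Proof. by move=> i1; rewrite /Int RintegralZl. Qed.

Lemma Int_le {f g} : intg f -> intg g -> (forall x, f x <= g x) -> Int f <= Int g.
Proof. by move=> i1 i2 fg; apply: le_Rintegral. Qed.

Lemma Int_ge0 f : (forall x, 0 <= f x) -> 0 <= Int f.
Proof. by move=> f0; apply: Rintegral_ge0. Qed.

Lemma Int_abs {f} : intg f -> `|Int f| <= Int (fun x => `|f x|).
Proof. by move=> i1; apply: le_normr_Rintegral. Qed.

Lemma eq_Int f g : f =1 g -> Int f = Int g.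
Proof. by move=> /funext ->. Qed.

Lemma eq_intg f g : f =1 g -> intg f -> intg g.
Proof. by move=> /funext ->. Qed.

Lemma EFin_Int {f} : intg f -> (Int f)%:E = (\int[mu]_x (f x)%:E)%E.
Proof. by move=> i1; rewrite /Int /Rintegral fineK//; apply: integrable_fin_num. Qed.

Lemma intg_ge0P f : meas f -> (forall x, 0 <= f x) ->
  (\int[mu]_x (f x)%:E < +oo)%E -> intg f.
Proof.
move=> mf f0 h; apply/integrableP; split; first exact/measurable_EFinP.
by under eq_integral do rewrite /= ger0_norm//.
Qed.

Lemma measurable_refl (c : R) :
  measurable_fun setT (fun x : measurableTypeR R => c - x : measurableTypeR R).
Proof. by apply: measurable_funB => //; exact: measurable_cst. Qed.

Lemma lebesgue_measure_refl (c : R) (A : set R) : measurable A ->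
  pushforward mu (fun x : measurableTypeR R => c - x : measurableTypeR R) A = mu A.
Proof.
move=> mA; apply/esym/lebesgue_measure_unique => //=; first exact: measurable_refl.
move=> _ _ [[a b]] _ <-; rewrite /pushforward.
have -> : (fun x : R => c - x) @^-1` `]a, b]%classic = `[c - b, c - a[%classic.
  by apply/seteqP; split => x /=; rewrite !in_itv/= => /andP[? ?]; apply/andP; split; lra.
rewrite !lebesgue_measure_itv/= !lte_fin.
have -> : (c - b < c - a) = (a < b) by apply/idP/idP; lra.
by case: ifP => // _; rewrite -!EFinB; congr EFin; lra.
Qed.

(** Reflection about c/2 has two uses: it places an even kernel at another point, and it annihilates
    integrands that are odd about a point. *)
Lemma Int_refl (c : R) f : intg f -> intg (fun x => f (c - x)) /\ Int (fun x => f (c - x)) = Int f.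
Proof.
move=> fi; pose phi := (fun x : measurableTypeR R => c - x : measurableTypeR R).
have mf := intg_meas fi.
have mfc : meas (fun x => f (c - x)).
  by apply: (measurableT_comp mf); exact: measurable_refl.
have int_pf (g : R -> \bar R) :
    (\int[pushforward mu phi]_x g x = \int[mu]_x g x)%E.
  apply: eq_measure_integral; first exact: measurable_refl.
  by move=> h A mA _; exact: lebesgue_measure_refl.
have ifc : intg (fun x => f (c - x)).
  apply/integrableP; split; first exact/measurable_EFinP.
  move/integrableP : (fi) => [_]; apply: le_lt_trans.
  have := @ge0_integral_pushforward _ _ _ _ R phi (measurable_refl c) mu setT
    (fun x => `|(f x)%:E|%E) measurableT.
  rewrite preimage_setT /= => <-//; last first.
    by apply/measurable_EFinP; apply: measurableT_comp.
  by rewrite int_pf.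
split=> //; rewrite /Int /Rintegral; congr fine.
have := @integral_pushforward _ _ _ _ R phi (measurable_refl c) mu setT
    (EFin \o f) _ _ measurableT.
rewrite preimage_setT /= int_pf => E; apply/esym; apply: E; last exact: ifc.
exact/measurable_EFinP.
Qed.

Lemma Int_odd (c : R) f : intg f -> (forall x, f (c - x) = - f x) -> Int f = 0.
Proof.
move=> fi fo; have [_] := Int_refl c fi.
rewrite (eq_Int (g := fun x => (-1) * f x)); last by move=> x; rewrite fo mulN1r.
by rewrite IntZ// => h; lra.
Qed.

Lemma aeS (P Q : R -> Prop) : {ae mu, forall x, P x} -> (forall x, P x -> Q x) ->
  {ae mu, forall x, Q x}.
Proof.
by move=> [N [mN N0 PN]] PQ; exists N; split=> // x nQ; apply: PN => /PQ.
Qed.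

Lemma aeI (P Q : R -> Prop) : {ae mu, forall x, P x} -> {ae mu, forall x, Q x} ->
  {ae mu, forall x, P x /\ Q x}.
Proof.
move=> [N [mN N0 PN]] [M [mM M0 QM]]; exists (N `|` M); split.
- exact: measurableU.
- by rewrite measureU0.
- move=> x /not_andP [nP|nQ]; [left; exact: PN|right; exact: QM].
Qed.

Lemma Int_dct (u : nat -> R -> R) f g : (forall n, meas (u n)) -> meas f ->
  {ae mu, forall x, u n x @[n --> \oo] --> f x} ->
  intg g -> (forall n x, `|u n x| <= g x) ->
  intg f /\ Int (u n) @[n --> \oo] --> Int f.
Proof.
move=> mu_ mf uf ig ug.
have iu n : intg (u n) by apply: (intg_le _ ig).
have [|||||h1 h2 h3] := @dominated_convergence _ _ R mu setT measurableT
  (fun n => EFin \o u n) (EFin \o f) (EFin \o g).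
- by move=> n; apply/measurable_EFinP; exact: mu_.
- exact/measurable_EFinP.
- by apply: (aeS uf) => x ux _; apply: cvg_EFin => //; exact: nearW.
- exact: ig.
- by apply: aeW => x n _ /=; rewrite lee_fin.
split; first exact: h1.
apply: (fine_cvg (f := fun n => \int[mu]_x (u n x)%:E)%E).
rewrite [X in _ --> X](_ : _ = (\int[mu]_x (EFin \o f) x)%E); first exact: h3.
by rewrite /Int /Rintegral fineK//; exact: integrable_fin_num h1.
Qed.

(** Since [f] is integrable, its integral is the limit of those over [-n, n] by dominated
    convergence, so a symmetric limit of the primitive determines it. *)
Lemma Int_ftc f F l : continuous f -> intg f ->
  (forall x, is_derive x (1:R) F (f x)) ->
  F n%:R - F (- n%:R) @[n --> \oo] --> l -> Int f = l.
Proof.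
move=> cf fi dF Fl.
have mf := intg_meas fi.
pose A n : set R := `[- n%:R, n%:R]%classic.
have [|||||_ h] := @Int_dct (fun n x => f x * \1_(A n) x) f (fun x => `|f x|).
- by move=> n; apply: measurable_funM => //; apply: measurable_indic; exact: measurable_itv.
- exact: mf.
- apply: aeW => x; apply: (@cvg_trans _ ((fun n : nat => f x) @ \oo)); last exact: cvg_cst.
  apply: near_eq_cvg; near=> n.
  have xn : x \in A n.
    by rewrite inE /A /= in_itv/= -ler_norml; near: n; exact: nbhs_infty_ger.
  by rewrite indicE xn mulr1.
- exact: intg_abs.
- move=> n x; rewrite normrM ler_piMr//.
  by rewrite indicE; case: (_ \in _); rewrite ?normr1 ?normr0.
apply/esym; apply: (@cvg_unique _ (@Rhausdorff R) _ _ _ _ Fl).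
apply: cvg_trans h; apply: near_eq_cvg; near=> n.
have n0 : (0 < n)%N by near: n; exact: nbhs_infty_gt.
rewrite /Int.
have -> : \int[mu]_x (f x * \1_(A n) x) = \int[mu]_(x in A n) f x.
  rewrite [RHS]Rintegral_mkcond; apply: eq_Rintegral => x _.
  by rewrite patchE indicE; case: (_ \in _); rewrite ?mulr1 ?mulr0.
rewrite /Rintegral (@continuous_FTC2 _ f F)//.
- have : (0:R) < n%:R by rewrite ltr0n.
  lra.
- exact: continuous_subspaceT.
- have cF x : {for x, continuous F}.
    by apply/differentiable_continuous/derivable1_diffP; case: (dF x).
  split.
  + by move=> x _; case: (dF x).
  + by apply: cvg_at_right_filter; exact: cF.
  + by apply: cvg_at_left_filter; exact: cF.
- by move=> x _; rewrite derive1E; case: (dF x).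
Unshelve. all: by end_near.
Qed.

End RealIntegral.

(** * The Poisson and conjugate Poisson kernels *)

Section Kernels.
Variable R : realType.
Notation mu := (@lebesgue_measure R).
Implicit Types f g k : R -> R.

(* [pi] times the Poisson kernel and the conjugate Poisson kernel of the half plane *)
Definition pk (y u : R) : R := y / (u ^+ 2 + y ^+ 2).
Definition qk (y u : R) : R := u / (u ^+ 2 + y ^+ 2).

Lemma den_gt0 (y u : R) : 0 < y -> 0 < u ^+ 2 + y ^+ 2.
Proof. by move=> y0; rewrite ltr_wpDl ?sqr_ge0// exprn_gt0. Qed.

Lemma pk_gt0 (y u : R) : 0 < y -> 0 < pk y u.
Proof. by move=> y0; rewrite divr_gt0// den_gt0. Qed.

Lemma pkN (y u : R) : pk y (- u) = pk y u.
Proof. by rewrite /pk sqrrN. Qed.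

Lemma qkN (y u : R) : qk y (- u) = - qk y u.
Proof. by rewrite /qk sqrrN mulNr. Qed.

Lemma pkB (y a b : R) : pk y (a - b) = pk y (b - a).
Proof. by rewrite -pkN opprB. Qed.

Lemma qkB (y a b : R) : qk y (a - b) = - qk y (b - a).
Proof. by rewrite -qkN opprB. Qed.

Lemma meas_den (y : R) : meas (fun u => u ^+ 2 + y ^+ 2).
Proof. by apply: measurable_funD => //; exact: measurable_funX. Qed.

Lemma meas_pk (y : R) : meas (pk y).
Proof. by apply: measurable_funM => //; apply: measurable_funV; exact: meas_den. Qed.

Lemma meas_qk (y : R) : meas (qk y).
Proof. by apply: measurable_funM => //; apply: measurable_funV; exact: meas_den. Qed.

Lemma continuous_den (y : R) : continuous (fun u : R => u ^+ 2 + y ^+ 2).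
Proof.
by move=> u; apply: cvgD; [exact: exprn_continuous|exact: cvg_cst].
Qed.

Lemma continuous_pk (y : R) : 0 < y -> continuous (pk y).
Proof.
move=> y0 u; apply: cvgM; first exact: cvg_cst.
by apply: cvgV; [rewrite gt_eqF ?den_gt0|exact: continuous_den].
Qed.

Lemma continuous_qk (y : R) : 0 < y -> continuous (qk y).
Proof.
move=> y0 u; apply: cvgM; first exact: cvg_id.
by apply: cvgV; [rewrite gt_eqF ?den_gt0|exact: continuous_den].
Qed.

(** The square is at most C / (1 + u^2). This class contains [qk], which decays only like 1/u, and a
    product of two of its members is integrable. *)
Definition sqdom (C : R) k := meas k /\ forall u, k u ^+ 2 <= C * pk 1 u.

Lemma sqr_den (y u a C : R) : 0 < y -> a ^+ 2 <= u ^+ 2 + y ^+ 2 ->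
  C = 1 + y ^- 2 -> (a / (u ^+ 2 + y ^+ 2)) ^+ 2 <= C * pk 1 u.
Proof.
move=> y0 aD ->; have D0 := den_gt0 u y0; have E0 := den_gt0 u (@ltr01 R).
apply: (@le_trans _ _ (u ^+ 2 + y ^+ 2)^-1).
  rewrite expr_div_n ler_pdivrMr ?exprn_gt0// expr2 mulrA mulVf ?gt_eqF//.
  by rewrite mul1r -expr2.
rewrite /pk mul1r ler_pdivlMr//.
rewrite -div1r mulrC mulrA mulr1 ler_pdivrMr//.
rewrite mulrDl mul1r mulrDr mulVf ?gt_eqF ?exprn_gt0//.
rewrite expr1n -[leRHS]addrA lerD2l.
have : 0 <= y ^- 2 * u ^+ 2 by rewrite mulr_ge0 ?invr_ge0 ?sqr_ge0.
have := sqr_ge0 y; lra.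
Qed.

Lemma sqdom_pk (y : R) : 0 < y -> sqdom (1 + y ^- 2) (pk y).
Proof.
move=> y0; split; first exact: meas_pk.
by move=> u; apply: sqr_den => //; rewrite lerDr sqr_ge0.
Qed.

Lemma sqdom_qk (y : R) : 0 < y -> sqdom (1 + y ^- 2) (qk y).
Proof.
move=> y0; split; first exact: meas_qk.
by move=> u; apply: sqr_den => //; rewrite lerDl sqr_ge0.
Qed.

(** Cleared of denominators this follows from t^2 <= 2 x^2 + 2 (x - t)^2, where the difference of
    the sides is (2x - t)^2. It makes [sqdom] stable under translation. *)
Lemma pk1_shift (x t : R) : pk 1 (x - t) <= 2 * (1 + x ^+ 2) * pk 1 t.
Proof.
rewrite /pk !mul1r ler_pdivlMr ?den_gt0// mulrC ler_pdivrMr ?den_gt0//.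
rewrite !expr1n.
have := sqr_ge0 (2 * x - t); have := sqr_ge0 (x * (x - t)); nra.
Qed.

Lemma sqdom_ge0 C k : sqdom C k -> 0 <= C.
Proof.
move=> [_ /(_ 0) h]; have := le_trans (sqr_ge0 _) h.
by rewrite pmulr_lge0// pk_gt0.
Qed.

Lemma meas_refl k (c : R) : meas k -> meas (fun t => k (c - t)).
Proof.
by move=> mk; apply: (measurableT_comp mk); exact: measurable_refl.
Qed.

Lemma sqdom_shift C k (x : R) : sqdom C k -> sqdom (C * (2 * (1 + x ^+ 2))) (fun t => k (x - t)).
Proof.
move=> sk; have C0 := sqdom_ge0 sk; have [mk hk] := sk.
split; first exact: meas_refl.
move=> u; apply: (le_trans (hk _)); rewrite -mulrA ler_wpM2l//.
exact: pk1_shift.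
Qed.

Lemma intg_pk1_pi : intg (pk (1:R)) /\ Int (pk (1:R)) = pi.
Proof.
have E : (\int[mu]_x (pk 1 x)%:E = (pi : R)%:E)%E.
  rewrite ge0_symfun_integralT.
  - have -> : pk 1 = (fun x => (oneDsqr x)^-1).
      by apply/funext => x; rewrite /pk mul1r /oneDsqr expr1n addrC.
    by rewrite -set_itvcy integral0y_oneDsqr -EFinM; congr EFin; lra.
  - by move=> x; rewrite ltW// pk_gt0.
  - exact: continuous_pk.
  - by move=> x /=; rewrite pkN.
split; last by rewrite /Int /Rintegral E.
apply: intg_ge0P; first exact: meas_pk.
  by move=> x; rewrite ltW// pk_gt0.
by rewrite E ltry.
Qed.

Lemma intg_mul_sqdom C1 C2 f g : sqdom C1 f -> sqdom C2 g -> intg (fun x => f x * g x).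
Proof.
move=> [mf hf] [mg hg].
apply: (@intg_le _ _ (fun x => (C1 + C2) / 2 * pk 1 x)).
- exact: measurable_funM.
- by apply: intgZ; exact: intg_pk1_pi.1.
move=> x; have := hf x; have := hg x; rewrite normrM.
rewrite -(real_normK (num_real (f x))) -(real_normK (num_real (g x))).
have := sqr_ge0 (`|f x| - `|g x|); nra.
Qed.

Lemma intg_pk (y : R) : 0 < y -> intg (pk y).
Proof.
move=> y0; apply: (@intg_le _ _ (fun x => (y + y^-1) * pk 1 x)).
- exact: meas_pk.
- by apply: intgZ; exact: intg_pk1_pi.1.
move=> u; rewrite gtr0_norm ?pk_gt0// /pk mul1r ler_pdivlMr ?den_gt0//.
rewrite mulrC mulrA ler_pdivrMr ?den_gt0// mulrDl.
have -> : (y + y^-1) * (u ^+ 2 + y ^+ 2) = y * u ^+ 2 + y ^+ 3 + y^-1 * u ^+ 2 + y.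
  by field; rewrite gt_eqF.
have : 0 < y ^+ 3 by rewrite exprn_gt0.
have : 0 <= y^-1 * u ^+ 2 by rewrite mulr_ge0 ?invr_ge0 ?sqr_ge0// ltW.
rewrite expr1n; nra.
Qed.

Lemma Int_pk (y : R) : 0 < y -> Int (pk y) = pi.
Proof.
move=> y0; apply: (@Int_ftc _ _ (fun u => atan (y^-1 * u))).
- exact: continuous_pk.
- exact: intg_pk.
- move=> u; apply: is_derive_eq; rewrite /pk /GRing.scale/= mulr1.
  field.
  by rewrite -?[1 + _]addrC !gt_eqF ?den_gt0.
have cat : atan (y^-1 * n%:R : R) @[n --> \oo] --> (pi / 2 : R).
  apply: (cvg_comp (fun n : nat => n%:R : R) (fun x => atan (y^-1 * x)) cvgr_idn).
  apply: cvg_comp (@cvgy_atan R).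
  by apply: gt0_cvgMry; rewrite ?invr_gt0//; exact: cvg_id.
rewrite (_ : pi = pi / 2 - (- (pi / 2))); last by lra.
apply: cvgB; first exact: cat.
under eq_fun do rewrite mulrN atanN.
by apply: cvgN.
Qed.

Lemma Int_pk_shift (y a : R) : 0 < y ->
  intg (fun t => pk y (a - t)) /\ Int (fun t => pk y (a - t)) = pi.
Proof. by move=> y0; rewrite -(Int_pk y0); apply: Int_refl; exact: intg_pk. Qed.

(** Neither term on the left is integrable alone; the right-hand side consists of products of
    [sqdom] functions, so the difference is. *)
Lemma qk_diffE (y w a b t : R) : 0 < y -> 0 < w ->
  qk w (b - t) - qk y (a - t) = (a - b) * (qk y (a - t) * qk w (b - t)) +
    y * (pk y (a - t) * qk w (b - t)) - w * (qk y (a - t) * pk w (b - t)).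
Proof.
move=> y0 w0; rewrite /qk /pk; field.
by rewrite !gt_eqF ?den_gt0.
Qed.

Lemma intg_qq (y w a b : R) : 0 < y -> 0 < w ->
  [/\ intg (fun t => qk y (a - t) * qk w (b - t)), intg (fun t => pk y (a - t) * qk w (b - t)),
     intg (fun t => qk y (a - t) * pk w (b - t)) & intg (fun t => pk y (a - t) * pk w (b - t))].
Proof.
move=> y0 w0.
by split; apply: intg_mul_sqdom; apply: sqdom_shift; (exact: sqdom_qk || exact: sqdom_pk).
Qed.

Lemma intg_qk_diff (y w a b : R) : 0 < y -> 0 < w ->
  intg (fun t => qk w (b - t) - qk y (a - t)).
Proof.
move=> y0 w0; have [i1 i2 i3 _] := intg_qq a b y0 w0.
apply: (eq_intg (fun t => esym (qk_diffE a b t y0 w0))).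
by apply: intgB; [apply: intgD|]; exact: intgZ.
Qed.

Lemma cvg_ln_den (y a : R) : 0 < y ->
  ln ((a - n%:R) ^+ 2 + y ^+ 2) - ln (n%:R ^+ 2) @[n --> \oo] --> (0 : R).
Proof.
move=> y0.
have c0 c : c / n%:R @[n --> \oo] --> (0 : R).
  rewrite -(mulr0 c); apply: cvgM; first exact: cvg_cst.
  apply/gtr0_cvgV0; last exact: cvgr_idn.
  by near=> n; rewrite ltr0n; near: n; exact: nbhs_infty_gt.
have : (a / n%:R - 1) ^+ 2 + (y / n%:R) ^+ 2 @[n --> \oo] --> (1 : R).
  rewrite [X in _ --> X](_ : 1 = (0 - 1) ^+ 2 + 0 ^+ 2 :> R); last by ring.
  have sq (u : nat -> R) (l : R) : u n @[n --> \oo] --> l -> u n ^+ 2 @[n --> \oo] --> l ^+ 2.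
    by move=> ul; rewrite expr2; under eq_fun do rewrite expr2; exact: cvgM.
  apply: cvgD; apply: sq; last exact: c0.
  by apply: cvgB; [exact: c0|exact: cvg_cst].
move=> h; have := cvg_comp _ _ h (continuous_ln (@ltr01 R)).
rewrite ln1; apply: cvg_trans; apply: near_eq_cvg; near=> n.
have n0 : 0 < n%:R :> R by rewrite ltr0n; near: n; exact: nbhs_infty_gt.
rewrite /= -ln_div ?posrE ?exprn_gt0 ?den_gt0//; congr ln.
by field; rewrite gt_eqF.
Unshelve. all: by end_near.
Qed.

Lemma Int_qk_diff (y w a b : R) : 0 < y -> 0 < w ->
  Int (fun t => qk w (b - t) - qk y (a - t)) = 0.
Proof.
move=> y0 w0.
(* A primitive of the integrand. At both ends each logarithm is compared with ln (n^2); these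
   comparison terms cancel, so [F] tends to 0. *)
pose F t := 2^-1 * (ln ((a - t) ^+ 2 + y ^+ 2) - ln ((b - t) ^+ 2 + w ^+ 2)).
apply: (@Int_ftc _ _ F).
- have cq z c : 0 < z -> continuous (fun t : R => qk z (c - t)).
    move=> z0 t; apply: (@continuous_comp _ _ _ (fun t : R => c - t) (qk z)).
      by apply: cvgB; [exact: cvg_cst|exact: cvg_id].
    exact: continuous_qk.
  by move=> t; apply: cvgB; exact: cq.
- exact: intg_qk_diff.
- move=> t; rewrite /F.
  have d (c z : R) : 0 < z -> is_derive t (1:R) (fun t => ln ((c - t) ^+ 2 + z ^+ 2))
      (- (2 * qk z (c - t))).
    move=> z0; have z1 := is_derive1_ln (den_gt0 (c - t) z0).
    have z2 : is_derive t (1:R) (fun t => (c - t) ^+ 2 + z ^+ 2) (- (2 * (c - t))).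
      by apply: is_derive_eq; rewrite /GRing.scale/=; ring.
    have := @is_derive1_comp _ (@ln R) _ t _ _ z1 z2.
    have -> // : - (2 * qk z (c - t)) = ((c - t) ^+ 2 + z ^+ 2)^-1 * - (2 * (c - t)).
    by rewrite /qk; field; rewrite gt_eqF ?den_gt0.
  have := d a y y0; have := d b w w0 => ? ?.
  by apply: is_derive_eq; rewrite /GRing.scale/=; field.
have Fn n : F n%:R = 2^-1 * ((ln ((a - n%:R) ^+ 2 + y ^+ 2) - ln (n%:R ^+ 2))
   - (ln ((b - n%:R) ^+ 2 + w ^+ 2) - ln (n%:R ^+ 2))) by rewrite /F; ring.
have FNn n : F (- n%:R) = 2^-1 * ((ln ((- a - n%:R) ^+ 2 + y ^+ 2) - ln (n%:R ^+ 2))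
   - (ln ((- b - n%:R) ^+ 2 + w ^+ 2) - ln (n%:R ^+ 2))).
  rewrite /F; have e c : (c - - n%:R) ^+ 2 = (- c - n%:R) ^+ 2 :> R by ring.
  by rewrite !e; ring.
have : F n%:R - F (- n%:R) @[n --> \oo] --> (2^-1 * (0 - 0) - 2^-1 * (0 - 0) : R).
  under eq_fun do rewrite Fn FNn.
  by apply: cvgB; apply: cvgM; try exact: cvg_cst; apply: cvgB; exact: cvg_ln_den.
by rewrite [X in _ --> X -> _]subrr.
Qed.

(** The integrands here and in [Int_pqqp] are the real and imaginary parts of 1 / ((a - t - iy) (b -
    t + iw)). Partial fractions write them through the difference of the two [qk], of integral 0,
    and the sum of the two [pk], of integral 2 pi. *)
Lemma Int_qqpp (y w a b : R) : 0 < y -> 0 < w ->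
  Int (fun t => qk y (a - t) * qk w (b - t) + pk y (a - t) * pk w (b - t))
  = 2 * pi * pk (y + w) (a - b).
Proof.
move=> y0 w0; have n0 := den_gt0 (a - b) (addr_gt0 y0 w0).
have [ia Ia] := Int_pk_shift a y0; have [ib Ib] := Int_pk_shift b w0.
have iD := intg_qk_diff a b y0 w0; have ID := Int_qk_diff a b y0 w0.
pose n := (a - b) ^+ 2 + (y + w) ^+ 2.
rewrite (@eq_Int _ _ (fun t => (a - b) / n * (qk w (b - t) - qk y (a - t))
   + (y + w) / n * (pk y (a - t) + pk w (b - t)))); last first.
  move=> t; rewrite /qk /pk /n; field.
  by rewrite (gt_eqF n0) !gt_eqF ?den_gt0.
rewrite IntD; [|exact: intgZ|exact/intgZ/intgD].
rewrite !IntZ ?(IntD ia ib)//; last exact: intgD.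
by rewrite ID Ia Ib /pk -/n; ring.
Qed.

Lemma Int_pqqp (y w a b : R) : 0 < y -> 0 < w ->
  Int (fun t => pk y (a - t) * qk w (b - t) - qk y (a - t) * pk w (b - t))
  = 2 * pi * qk (y + w) (b - a).
Proof.
move=> y0 w0; have n0 := den_gt0 (a - b) (addr_gt0 y0 w0).
have [ia Ia] := Int_pk_shift a y0; have [ib Ib] := Int_pk_shift b w0.
have iD := intg_qk_diff a b y0 w0; have ID := Int_qk_diff a b y0 w0.
pose n := (a - b) ^+ 2 + (y + w) ^+ 2.
rewrite (@eq_Int _ _ (fun t => (y + w) / n * (qk w (b - t) - qk y (a - t))
   - (a - b) / n * (pk y (a - t) + pk w (b - t)))); last first.
  move=> t; rewrite /qk /pk /n; field.
  by rewrite (gt_eqF n0) !gt_eqF ?den_gt0.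
rewrite IntB; [|exact: intgZ|exact/intgZ/intgD].
rewrite !IntZ ?(IntD ia ib)//; last exact: intgD.
by rewrite ID Ia Ib /qk -sqrrN opprB -/n; ring.
Qed.

End Kernels.

(** * Interchange of integrals *)

Section Fubini.
Variable R : realType.
Notation mu := (@lebesgue_measure R).
Implicit Types f g k : R -> R.

Definition meas2 (F : R -> R -> R) := measurable_fun [set: R * R] (fun p => F p.1 p.2).

Lemma meas2_swap F : meas2 F -> meas2 (fun x y => F y x).
Proof.
move=> mF; apply: (@measurableT_comp _ _ _ _ _ _ (fun p => F p.1 p.2) _ (fun p : R * R => (p.2, p.1))) => //.
by apply: measurable_fun_pair; [exact: measurable_snd|exact: measurable_fst].
Qed.

Lemma meas2_conv A f k : meas A -> meas f -> meas k ->
  meas2 (fun x t => A t * (f x * k (x - t))).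
Proof.
move=> mA mf mk; apply: measurable_funM.
  exact: (measurableT_comp mA measurable_snd).
apply: measurable_funM; first exact: (measurableT_comp mf measurable_fst).
by apply: (measurableT_comp mk); apply: measurable_funB.
Qed.

Lemma meas2_sect F x : meas2 F -> meas (F x).
Proof.
move=> mF; apply: (@measurableT_comp _ _ _ _ _ _ (fun p => F p.1 p.2) _ (fun t : R => (x, t))) => //.
exact: measurable_fun_pair.
Qed.

Lemma meas_Int2 F : meas2 F -> meas (fun t => Int (fun x => F x t)).
Proof.
move=> mF; rewrite /meas /Int /Rintegral.
apply: (@measurableT_comp _ _ _ _ _ _ (@fine R)) => //.
under eq_fun do rewrite integralE.
have mE : measurable_fun [set: R * R] (fun p => (F p.1 p.2)%:E) by exact/measurable_EFinP.
apply: emeasurable_funB.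
- have h := @measurable_fun_fubini_tonelli_G _ _ _ _ _ mu _ (measurable_funepos mE) (fun=> funepos_ge0 _ _).
  by apply: eq_measurable_fun h => y _; apply: eq_integral => x _; rewrite ?funeposE ?funenegE.
- have h := @measurable_fun_fubini_tonelli_G _ _ _ _ _ mu _ (measurable_funeneg mE) (fun=> funeneg_ge0 _ _).
  by apply: eq_measurable_fun h => y _; apply: eq_integral => x _; rewrite ?funeposE ?funenegE.
Qed.

(** A product majorant gives all integrability side conditions at once. In [conv_swap], [a] is a
    multiple of the indicator of (-1, 1) and [b] a multiple of [pk 1]. *)
Lemma Int_Fubini F a b : meas2 F -> intg a -> intg b ->
  (forall x t, `|F x t| <= a x * b t) ->
  [/\ forall x, intg (F x), forall t, intg (fun x => F x t),
     intg (fun x => Int (F x)), intg (fun t => Int (fun x => F x t))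
   & Int (fun x => Int (F x)) = Int (fun t => Int (fun x => F x t))].
Proof.
move=> mF ia ib Fab.
have i1 x : intg (F x).
  by apply: (intg_le (meas2_sect x mF) (intgZ (a x) ib)) => t; exact: Fab.
have i2 t : intg (fun x => F x t).
  apply: (intg_le (meas2_sect t (meas2_swap mF)) (intgZ (b t) ia)) => x.
  by rewrite mulrC; exact: Fab.
have i3 : intg (fun x => Int (F x)).
  apply: (@intg_le _ _ (fun x => Int (fun t => `|b t|) * `|a x|)).
  - exact: meas_Int2 (meas2_swap mF).
  - exact/intgZ/intg_abs.
  move=> x; apply: (le_trans (Int_abs (i1 x))); rewrite mulrC -IntZ//; last exact: intg_abs.
  apply: Int_le; [exact: intg_abs|exact/intgZ/intg_abs|].
  by move=> t; apply: (le_trans (Fab x t)); rewrite -normrM ler_norm.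
have i4 : intg (fun t => Int (fun x => F x t)).
  apply: (@intg_le _ _ (fun t => Int (fun x => `|a x|) * `|b t|)).
  - exact: meas_Int2.
  - exact/intgZ/intg_abs.
  move=> t; apply: (le_trans (Int_abs (i2 t))); rewrite mulrC -IntZ//; last exact: intg_abs.
  apply: Int_le; [exact: intg_abs|exact/intgZ/intg_abs|].
  by move=> x; apply: (le_trans (Fab x t)); rewrite mulrC -normrM ler_norm.
split; [exact: i1|exact: i2|exact: i3|exact: i4|].
have mE : measurable_fun [set: R * R] (fun p => (F p.1 p.2)%:E) by exact/measurable_EFinP.
have iE : (mu \x mu)%E.-integrable [set: R * R] (fun p => (F p.1 p.2)%:E).
  apply: (proj2 (@integrable12ltyP _ _ _ _ R mu mu (fun p => (F p.1 p.2)%:E) mE)) => /=.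
  apply: (@le_lt_trans _ _ (\int[mu]_x (Int (fun t => `|b t|) * `|a x|)%:E)%E).
    apply: ge0_le_integral => //.
    - by move=> x _; exact: integral_ge0.
    - apply: (@measurable_fun_fubini_tonelli_F _ _ _ _ _ mu (fun p => `|(F p.1 p.2)%:E|%E)) => //.
      exact: measurableT_comp.
    - by apply/measurable_EFinP; apply: intg_meas; exact/intgZ/intg_abs.
    move=> x _; rewrite -EFin_Int; last exact/intg_abs/i1.
    rewrite lee_fin mulrC -IntZ//; last exact: intg_abs.
    apply: Int_le; [exact: intg_abs|exact/intgZ/intg_abs|].
    by move=> t; apply: (le_trans (Fab x t)); rewrite -normrM ler_norm.
  by rewrite -EFin_Int ?ltry//; exact/intgZ/intg_abs.
apply: EFin_inj; rewrite (EFin_Int i3) (EFin_Int i4).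
under eq_integral do rewrite EFin_Int//.
under [RHS]eq_integral do rewrite EFin_Int//.
exact: Fubini iE.
Qed.

End Fubini.

(** * Convolutions of bounded functions on (-1, 1) with the kernels *)

Section Potential.
Variable R : realType.
Notation mu := (@lebesgue_measure R).
Implicit Types f g k A : R -> R.
Let I := @I11 R.

Definition bsupp M f := meas f /\ forall x, `|f x| <= M * \1_I x.

Lemma indicI_ge0 (x : R) : 0 <= \1_I x :> R.
Proof. by rewrite indicE; case: (_ \in _). Qed.

Lemma bsupp_ge0 M f : bsupp M f -> 0 <= M.
Proof.
move=> [_ /(_ 0)]; rewrite indicE mem_set ?mulr1; first exact: le_trans.
by rewrite /I /I11 /= in_itv /=; apply/andP; split; lra.
Qed.

Lemma intgI : intg (\1_I : R -> R).
Proof. exact: (@integrable_indic_itv R (-1) 1 false true). Qed.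

Lemma IntI : Int (\1_I : R -> R) = 2.
Proof.
rewrite /Int /Rintegral /I /I11 integral_indic//= setIT.
by rewrite lebesgue_measure_itv/= lte_fin; case: ltP => //=; lra.
Qed.

Lemma bsupp_intg M f : bsupp M f -> intg f.
Proof. by move=> [mf fM]; apply: (intg_le mf _ fM); apply: intgZ; exact: intgI. Qed.

Lemma bsupp_out M f x : bsupp M f -> ~ I x -> f x = 0.
Proof.
by move=> [_ /(_ x)]; rewrite indicE => + nI; rewrite memNset// mulr0 normr_le0 => /eqP.
Qed.

Lemma bsupp_bnd M f x : bsupp M f -> `|f x| <= M.
Proof.
move=> bf; have M0 := bsupp_ge0 bf; apply: (le_trans (bf.2 x)).
by rewrite ler_piMr// indicE; case: (_ \in _).
Qed.

(** The kernel is taken at [x - t], in accordance with the kernel 1 / (x - t) and the sign of the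
    finite Hilbert transform. *)
Definition conv f k t : R := Int (fun x => f x * k (x - t)).

(** The 4 bounds the factor 2 (1 + x^2) of [pk1_shift] for x in (-1, 1); the estimate is thus
    uniform in x. *)
Lemma sqdom_sqrt C k x t : sqdom C k -> I x -> `|k (x - t)| <= Num.sqrt (4 * C * pk 1 t).
Proof.
move=> sk Ix; have C0 := sqdom_ge0 sk.
have p0 : 0 <= pk 1 t by rewrite ltW// pk_gt0.
rewrite -sqrtr_sqr ler_wsqrtr//; have [_ /(_ t) h] := sqdom_shift x sk.
apply: (le_trans h); rewrite ler_wpM2r//.
move: Ix; rewrite /I /I11 /= in_itv/= => /andP[? ?].
have : x ^+ 2 <= 1 by nra.
nra.
Qed.

Lemma bsupp_sqdom M C f k : bsupp M f -> sqdom C k -> intg (fun x => f x * k x).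
Proof.
move=> bf sk; have M0 := bsupp_ge0 bf; have C0 := sqdom_ge0 sk.
apply: (@intg_le _ _ (fun x => M * (\1_I x + C * pk 1 x))).
- by apply: measurable_funM; [exact: bf.1|exact: sk.1].
- by apply: intgZ; apply: intgD; [exact: intgI|exact: intgZ (intg_pk1_pi R).1].
move=> x; have p0 : 0 <= pk 1 x by rewrite ltW// pk_gt0.
have [Ix|nIx] := pselect (I x); last first.
  rewrite (bsupp_out bf nIx) mul0r normr0; apply: mulr_ge0 => //.
  by apply: addr_ge0; [exact: indicI_ge0|exact: mulr_ge0].
rewrite normrM; apply: ler_pM => //; first exact: bsupp_bnd bf.
rewrite indicE mem_set//=; have := sk.2 x; rewrite -(real_normK (num_real (k x))).
have := sqr_ge0 (`|k x| - 1); nra.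
Qed.

(** Averaging over a bounded interval preserves the decay, so products of two convolutions are
    integrable. The constant is (2 M)^2 times 4 C, where 2 is the length of (-1, 1). *)
Lemma sqdom_conv M C f k : bsupp M f -> sqdom C k ->
  (forall t, intg (fun x => f x * k (x - t))) /\ sqdom (16 * M ^+ 2 * C) (conv f k).
Proof.
move=> bf sk; have C0 := sqdom_ge0 sk; have M0 := bsupp_ge0 bf.
have p0 (t : R) : 0 <= pk 1 t by rewrite ltW// pk_gt0.
have m2 : meas2 (fun x t => f x * k (x - t)).
  have := @meas2_conv R (fun=> 1) f k (measurable_cst _) bf.1 sk.1.
  by congr measurable_fun; apply/funext => p; rewrite mul1r.
have B x t : `|f x * k (x - t)| <= M * Num.sqrt (4 * C * pk 1 t) * \1_I x.
  have [Ix|nIx] := pselect (I x); last first.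
    by rewrite (bsupp_out bf nIx) mul0r normr0 !mulr_ge0// ?sqrtr_ge0// indicI_ge0.
  rewrite normrM indicE mem_set// mulr1; apply: ler_pM => //; last exact: sqdom_sqrt.
  exact: bsupp_bnd bf.
have i1 t : intg (fun x => f x * k (x - t)).
  apply: (intg_le (meas2_sect t (meas2_swap m2)) _ (B^~ t)).
  exact/intgZ/intgI.
split=> //; split; first exact: meas_Int2.
move=> t; rewrite -(real_normK (num_real _)).
have : `|conv f k t| <= 2 * M * Num.sqrt (4 * C * pk 1 t).
  apply: (le_trans (Int_abs (i1 t))).
  apply: (@le_trans _ _ (Int (fun x => M * Num.sqrt (4 * C * pk 1 t) * \1_I x))).
    by apply: Int_le; [exact/intg_abs|exact/intgZ/intgI|move=> x; exact: B].
  by rewrite IntZ ?IntI; [lra|exact: intgI].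
move=> h; apply: (@le_trans _ _ ((2 * M * Num.sqrt (4 * C * pk 1 t)) ^+ 2)).
  by rewrite ler_sqr ?nnegrE// !mulr_ge0// sqrtr_ge0.
rewrite exprMn sqr_sqrtr; last by apply: mulr_ge0 => //; apply: mulr_ge0.
by rewrite le_eqVlt; apply/orP; left; apply/eqP; ring.
Qed.

Lemma conv_swap M C C' f k A : bsupp M f -> sqdom C k -> sqdom C' A ->
  intg (fun x => f x * Int (fun t => A t * k (x - t))) /\
  Int (fun t => A t * conv f k t) = Int (fun x => f x * Int (fun t => A t * k (x - t))).
Proof.
move=> bf sk sA; have C0 := sqdom_ge0 sk; have C'0 := sqdom_ge0 sA; have M0 := bsupp_ge0 bf.
have p0 (t : R) : 0 <= pk 1 t by rewrite ltW// pk_gt0.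
pose F x t := A t * (f x * k (x - t)).
have mF : meas2 F by apply: meas2_conv; [exact: sA.1|exact: bf.1|exact: sk.1].
have iAk x : intg (fun t => A t * k (x - t)) by apply: (intg_mul_sqdom sA); exact: sqdom_shift sk.
have Fx x : Int (F x) = f x * Int (fun t => A t * k (x - t)).
  by rewrite -IntZ//; apply: eq_Int => t; rewrite /F mulrCA.
have [|||i1 i2 i3 i4 E] := @Int_Fubini R F (fun x => M * \1_I x) (fun t => (C' + 4 * C) / 2 * pk 1 t) mF.
- exact/intgZ/intgI.
- exact: intgZ (intg_pk1_pi R).1.
- move=> x t; have [Ix|nIx] := pselect (I x); last first.
    rewrite /F (bsupp_out bf nIx) mul0r mulr0 normr0; apply: mulr_ge0.
      by apply: mulr_ge0 => //; exact: indicI_ge0.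
    by apply: mulr_ge0 => //; lra.
  rewrite /F mulrCA normrM indicE mem_set// mulr1; apply: ler_pM => //.
    exact: bsupp_bnd bf.
  have h1 := sqdom_sqrt t sk Ix; have h2 := sA.2 t.
  have h3 : `|k (x - t)| ^+ 2 <= 4 * C * pk 1 t.
    rewrite -[leRHS]sqr_sqrtr; last by apply: mulr_ge0 => //; apply: mulr_ge0.
    by rewrite ler_sqr ?nnegrE// sqrtr_ge0.
  rewrite normrM; rewrite -(real_normK (num_real (A t))) in h2.
  have := sqr_ge0 (`|A t| - `|k (x - t)|); nra.
split; first exact: eq_intg i3.
rewrite (@eq_Int _ _ (fun t => Int (fun x => F x t))); last first.
  by move=> t; rewrite /conv -IntZ//; have [h _] := sqdom_conv bf sk; exact: h.
by rewrite -E; exact: eq_Int.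
Qed.

Definition Qf f y := conv f (qk y).
Definition Pf f y := conv f (pk y).

(** The two convolutions are unfolded in turn, which leaves inside the inner product of two shifted
    kernels, known in closed form. *)
Lemma Int_conv2 M C1 C2 f k1 k2 : bsupp M f -> sqdom C1 k1 -> sqdom C2 k2 ->
  [/\ intg (fun t => conv f k1 t * conv f k2 t),
   (forall x, intg (fun x' => f x' * Int (fun t => k2 (x - t) * k1 (x' - t)))),
   intg (fun x => f x * Int (fun x' => f x' * Int (fun t => k2 (x - t) * k1 (x' - t)))) &
   Int (fun t => conv f k1 t * conv f k2 t) =
   Int (fun x => f x * Int (fun x' => f x' * Int (fun t => k2 (x - t) * k1 (x' - t))))].
Proof.
move=> bf s1 s2.
have [_ c1] := sqdom_conv bf s1; have [_ c2] := sqdom_conv bf s2.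
have [i1 E1] := conv_swap bf s2 c1.
have h x := conv_swap bf s1 (sqdom_shift x s2).
have e x : f x * Int (fun t => conv f k1 t * k2 (x - t)) =
   f x * Int (fun x' => f x' * Int (fun t => k2 (x - t) * k1 (x' - t))).
  have [_ <-] := h x; congr (_ * _); apply: eq_Int => t; exact: mulrC.
split.
- exact: intg_mul_sqdom c1 c2.
- by move=> x; have [] := h x.
- exact: eq_intg e i1.
- by rewrite E1; exact: eq_Int.
Qed.

(** The polarised energy identity: the heights stay independent because the cross terms are needed
    to expand differences of Q at two heights. *)
Lemma QP_energy M f y w : bsupp M f -> 0 < y -> 0 < w ->
  Int (fun t => Qf f y t * Qf f w t + Pf f y t * Pf f w t) =
  2 * pi * Int (fun x => f x * Pf f (y + w) x).
Proof.
move=> bf y0 w0; have sqy := sqdom_qk y0; have sqw := sqdom_qk w0.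
have spy := sqdom_pk y0; have spw := sqdom_pk w0.
have [a1 a2 a3 a4] := Int_conv2 bf sqy sqw.
have [b1 b2 b3 b4] := Int_conv2 bf spy spw.
have [_ cp] := sqdom_conv bf (sqdom_pk (addr_gt0 y0 w0)).
rewrite /Qf /Pf (IntD a1 b1) a4 b4 -(IntD a3 b3) -(IntZ _ (bsupp_sqdom bf cp)).
apply: eq_Int => x; rewrite -mulrDr -(IntD (a2 x) (b2 x)) mulrCA; congr (_ * _).
rewrite /conv -IntZ; last by have [h _] := sqdom_conv bf (sqdom_pk (addr_gt0 y0 w0)); exact: h.
apply: eq_Int => x'; have [h1 h2 h3 h4] := intg_qq x x' w0 y0.
rewrite -mulrDr -(IntD h1 h4) (Int_qqpp x x' w0 y0) pkB (addrC w).
by rewrite mulrCA.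
Qed.

Lemma QP_semigroup M f s w t : bsupp M f -> 0 < s -> 0 < w ->
  Int (fun x => Qf f w x * pk s (x - t)) + Int (fun x => Pf f w x * qk s (x - t))
  = 2 * pi * Qf f (s + w) t.
Proof.
move=> bf s0 w0; have sqs := sqdom_qk s0; have sqw := sqdom_qk w0.
have sps := sqdom_pk s0; have spw := sqdom_pk w0.
have [i1 E1] := conv_swap bf sqw (sqdom_shift t sps).
have [i2 E2] := conv_swap bf spw (sqdom_shift t sqs).
rewrite (@eq_Int _ _ (fun x => pk s (t - x) * Qf f w x)); last first.
  by move=> x; rewrite mulrC pkB.
(* [qk] is odd, so reversing its argument turns the sum into the difference evaluated by
   [Int_pqqp]. *)
rewrite (@eq_Int _ (fun x => Pf f w x * _) (fun x => - 1 * (qk s (t - x) * Pf f w x))); last first.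
  by move=> x; rewrite mulrC qkB mulN1r mulNr.
rewrite IntZ; last first.
  by have [_ c] := sqdom_conv bf spw; apply: intg_mul_sqdom c; exact: sqdom_shift sqs.
rewrite mulN1r E1 E2 -(IntB i1 i2) -IntZ; last by have [h _] := sqdom_conv bf (sqdom_qk (addr_gt0 s0 w0)); exact: h.
apply: eq_Int => x; have [h1 h2 h3 h4] := intg_qq t x s0 w0.
by rewrite -mulrBr -(IntB h2 h3) (Int_pqqp t x s0 w0) mulrCA.
Qed.

End Potential.

(** * Poisson averages and truncated kernels at Lebesgue points *)

Section LebesguePoint.
Variable R : realType.
Notation mu := (@lebesgue_measure R).
Implicit Types f g m : R -> R.

Lemma pk_ge0 (y u : R) : 0 < y -> 0 <= pk y u.
Proof. by move=> y0; rewrite ltW// pk_gt0. Qed.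

Lemma pk_le1 (s u : R) : 0 < s -> pk s u <= (s + s^-1) * pk 1 u.
Proof.
move=> s0; rewrite /pk mul1r ler_pdivlMr ?den_gt0//.
rewrite mulrC mulrA ler_pdivrMr ?den_gt0// mulrDl.
have -> : (s + s^-1) * (u ^+ 2 + s ^+ 2) = s * u ^+ 2 + s ^+ 3 + s^-1 * u ^+ 2 + s.
  by field; rewrite gt_eqF.
have : 0 < s ^+ 3 by rewrite exprn_gt0.
have : 0 <= s^-1 * u ^+ 2 by rewrite mulr_ge0 ?invr_ge0 ?sqr_ge0// ltW.
rewrite expr1n; nra.
Qed.

Lemma pk_le_inv (s u : R) : 0 < s -> pk s u <= s^-1.
Proof.
move=> s0; rewrite /pk ler_pdivrMr ?den_gt0// -[s^-1]div1r mulrAC mul1r.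
by rewrite ler_pdivlMr// -expr2 lerDr sqr_ge0.
Qed.

Lemma pk_le_far (s r u : R) : 0 < s -> 0 < r -> r <= `|u| -> pk s u <= s / r ^+ 2.
Proof.
move=> s0 r0 ru; rewrite /pk ler_pM2l// lef_pV2 ?posrE ?exprn_gt0 ?den_gt0//.
rewrite -(real_normK (num_real u)).
by have := sqr_ge0 s; nra.
Qed.

Lemma pk_le_far1 (s r u : R) : 0 < s -> 0 < r -> r <= `|u| ->
  pk s u <= s * (1 + r ^- 2) * pk 1 u.
Proof.
move=> s0 r0 ru.
have r2 : 0 < r ^+ 2 by rewrite exprn_gt0.
have u2 : r ^+ 2 <= u ^+ 2 by rewrite -(real_normK (num_real u)) ler_sqr ?nnegrE// ltW.
have u2r : 1 <= r ^- 2 * u ^+ 2 by rewrite mulrC ler_pdivlMr// mul1r.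
rewrite /pk mul1r ler_pdivlMr ?den_gt0// mulrC mulrA ler_pdivrMr ?den_gt0//.
rewrite mulrC -mulrA ler_pM2l// expr1n mulrDl mul1r mulrDr.
have := sqr_ge0 s; have : 0 <= r ^- 2 * s ^+ 2 by rewrite mulr_ge0 ?sqr_ge0 ?invr_ge0 ?ltW.
lra.
Qed.

Definition sball (t r : R) : R -> R := \1_(ball t r : set R).

Lemma sballE t r x : sball t r x = (`|x - t| < r)%R%:R.
Proof.
rewrite /sball indicE distrC; congr (_%:R); congr (nat_of_bool _).
by apply/idP/idP; rewrite inE.
Qed.

Lemma sball_ge0 t r x : 0 <= sball t r x.
Proof. by rewrite sballE. Qed.

Lemma sball_le1 t r x : sball t r x <= 1.
Proof. by rewrite sballE; case: (_ < _). Qed.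

Lemma meas_sball t r : meas (sball t r).
Proof. by apply: measurable_indic; exact: measurable_ball. Qed.

(** The ball is cut into dyadic shells. The kernel is at most 1/s on the inner ball and at most 4 s
    / r^2 for r/2 <= |x - t| < r; with ball integrals of size o(r) the shells sum geometrically. The
    part away from [t] is O(s). *)
Lemma poisson_lebesgue_pt m t : meas m -> (forall x, 0 <= m x) ->
  intg (fun x => m x * pk 1 (x - t)) ->
  (forall e, 0 < e -> exists2 d, 0 < d &
     forall r, 0 < r < d -> Int (fun x => m x * sball t r x) <= e * r) ->
  forall e, 0 < e -> exists2 d, 0 < d &
     forall s, 0 < s < d -> intg (fun x => m x * pk s (x - t)) /\
       Int (fun x => m x * pk s (x - t)) <= e.
Proof.
move=> mm m0 im lpt e e0.
have mks s : meas (fun x => pk s (x - t)).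
  by apply: (measurableT_comp (meas_pk s)); exact: measurable_funB.
have is_ s : 0 < s -> intg (fun x => m x * pk s (x - t)).
  move=> s0; apply: (@intg_le _ _ (fun x => (s + s^-1) * (m x * pk 1 (x - t)))).
  - by apply: measurable_funM; [exact: mm|exact: mks].
  - exact: intgZ.
  move=> x; rewrite ger0_norm; last by apply: mulr_ge0 => //; exact: pk_ge0.
  by rewrite [leRHS]mulrCA ler_wpM2l//; exact: pk_le1.
have ir s r : 0 < s -> intg (fun x => m x * pk s (x - t) * sball t r x).
  move=> s0; apply: (intg_le _ (is_ s s0)).
    apply: measurable_funM; last exact: meas_sball.
    by apply: measurable_funM; [exact: mm|exact: mks].
  move=> x; have h : 0 <= m x * pk s (x - t) by apply: mulr_ge0 => //; exact: pk_ge0.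
  by rewrite ger0_norm ?ler_piMr// ?sball_le1// mulr_ge0 ?sball_ge0.
have ib r : 0 < r -> intg (fun x => m x * sball t r x).
  move=> r0; apply: (@intg_le _ _ (fun x => (r ^+ 2 + 1) * (m x * pk 1 (x - t)))).
  - by apply: measurable_funM => //; exact: meas_sball.
  - exact: intgZ.
  move=> x; rewrite ger0_norm; last by apply: mulr_ge0 => //; exact: sball_ge0.
  rewrite [leRHS]mulrCA ler_wpM2l// sballE; case: ltP => h; last first.
    by rewrite mulr_ge0 ?pk_ge0// addr_ge0 ?sqr_ge0.
  rewrite /pk mul1r ler_pdivlMr ?den_gt0// mul1r expr1n lerD2r.
  by rewrite -(real_normK (num_real _)) ler_sqr ?nnegrE// ltW.
(* The shells will add up to at most 9 times this quantity, which is e/2. *)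
have [d d0 hd] := lpt (e / 18) (divr_gt0 e0 (ltr0n _ 18)).
pose K := Int (fun x => m x * pk 1 (x - t)).
have K0 : 0 <= K by apply: Int_ge0 => x; apply: mulr_ge0 => //; exact: pk_ge0.
(* [s * D] bounds the far part; [K + 1] replaces [K] to have a positive divisor. *)
pose D := (1 + (d / 2) ^- 2) * (K + 1).
have D0 : 0 < D.
  apply: mulr_gt0; last by lra.
  by rewrite ltr_wpDr// invr_ge0 sqr_ge0.
exists (Num.min d (e / 2 / D)).
  by rewrite lt_min d0/= !divr_gt0.
move=> s /andP[s0]; rewrite lt_min => /andP[sd sD]; split; first exact: is_.
pose J r := Int (fun x => m x * pk s (x - t) * sball t r x).
(* The correction [- 4 * (s / r)] closes the induction: passing from r/2 to r adds 4 s/r to 9 - 8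
   s/r. In the base case s/r <= 2, so the bracket is at least 1. *)
have step N r : s / 2 <= r -> r <= s * 2 ^+ N -> r < d ->
    J r <= e / 18 * (9 - 4 * (s / r)).
  elim: N r => [|N IH] r r1 r2 rd.
    have r0 : 0 < r by lra.
    rewrite expr0 mulr1 in r2.
    apply: (@le_trans _ _ (s^-1 * (e / 18 * r))).
      apply: (@le_trans _ _ (s^-1 * Int (fun x => m x * sball t r x))).
        rewrite -IntZ; last exact: ib.
        apply: Int_le; [exact: ir|by apply: intgZ; exact: ib|].
        move=> x; rewrite mulrAC mulrC ler_wpM2r//; last exact: pk_le_inv.
        by rewrite mulr_ge0// sball_ge0.
      by rewrite ler_wpM2l ?invr_ge0 ?(ltW s0)//; apply: hd; rewrite r0 rd.
    have h1 : s / r <= 2 by rewrite ler_pdivrMr//; lra.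
    have h2 : s^-1 * r <= 1 by rewrite mulrC ler_pdivrMr// mul1r.
    by rewrite mulrCA ler_pM2l ?divr_gt0//; lra.
  have [rs|rs] := leP r (s * 2 ^+ N); first exact: IH.
  have s2N : s <= s * 2 ^+ N by rewrite ler_peMr ?(ltW s0)// exprn_ege1// ler1n.
  have r0 : 0 < r by lra.
  have h := IH (r / 2) _ _ _.
  apply: (@le_trans _ _ (J (r / 2) + s / (r / 2) ^+ 2 * (e / 18 * r))).
    apply: (@le_trans _ _ (J (r / 2) + s / (r / 2) ^+ 2 * Int (fun x => m x * sball t r x))).
      rewrite /J -IntZ; last exact: ib.
      rewrite -IntD; [|exact: ir|by apply: intgZ; exact: ib].
      apply: Int_le; [exact: ir|by apply: intgD; [exact: ir|apply: intgZ; exact: ib]|].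
      move=> x.
      have -> : m x * pk s (x - t) * sball t (r / 2) x + s / (r / 2) ^+ 2 * (m x * sball t r x)
        = m x * (pk s (x - t) * sball t (r / 2) x + s / (r / 2) ^+ 2 * sball t r x) by ring.
      rewrite -mulrA ler_wpM2l//.
      rewrite !sballE; case: (ltP _ r) => hr; last first.
        rewrite !mulr0 addr0 mulr_ge0// pk_ge0//.
      rewrite !mulr1; case: ltP => hr2.
        by rewrite mulr1 lerDl divr_ge0 ?sqr_ge0 ?ltW.
      by rewrite mulr0 add0r; apply: pk_le_far => //; lra.
    by rewrite lerD2l ler_wpM2l ?divr_ge0 ?sqr_ge0 ?(ltW s0)//; apply: hd; rewrite r0 rd.
  have e1 : s / (r / 2) ^+ 2 * (e / 18 * r) = e / 18 * (4 * (s / r)) by field; rewrite gt_eqF.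
  have e2 : s / (r / 2) = 2 * (s / r) by field; rewrite gt_eqF.
  rewrite e1; rewrite e2 in h.
  have : J (r / 2) <= e / 18 * (9 - 4 * (2 * (s / r))).
    apply: h; [lra| |lra].
    by rewrite exprS in r2; lra.
  by lra.
have [N hN] : exists N, d / 2 <= s * 2 ^+ N.
  exists (Num.truncn (d / 2 / s)).+1.
  rewrite [leRHS]mulrC -ler_pdivrMr//; apply: ltW; apply: (lt_le_trans (truncnS_gt _)).
  by rewrite -natrX ler_nat ltnW// ltn_expl.
have [sd2|sd2] := leP (s / 2) (d / 2); last by lra.
have hJ := step N (d / 2) sd2 hN ltac:(lra).
apply: (@le_trans _ _ (J (d / 2) + s * (1 + (d / 2) ^- 2) * K)).
  rewrite /J /K -IntZ// -IntD//; [|exact: ir|exact: intgZ].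
  apply: Int_le; [exact: is_|by apply: intgD; [exact: ir|exact: intgZ]|].
  move=> x.
  have -> : m x * pk s (x - t) * sball t (d / 2) x + s * (1 + (d / 2) ^- 2) * (m x * pk 1 (x - t))
    = m x * (pk s (x - t) * sball t (d / 2) x + s * (1 + (d / 2) ^- 2) * pk 1 (x - t)) by ring.
  rewrite ler_wpM2l// sballE.
  case: ltP => h.
    rewrite mulr1 lerDl mulr_ge0 ?pk_ge0// mulr_ge0 ?ltW//.
    by rewrite ltr_wpDr// invr_ge0 sqr_ge0.
  by rewrite mulr0 add0r; apply: pk_le_far1 => //; lra.
have h1 : s * (1 + (d / 2) ^- 2) * K <= e / 2.
  apply: (@le_trans _ _ (s * D)).
    rewrite /D -mulrA ler_pM2l// ler_wpM2l//; last by lra.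
    by rewrite addr_ge0// invr_ge0 sqr_ge0.
  by move: sD; rewrite ltr_pdivlMr// => /ltW.
have h2 : 0 <= s / (d / 2) by rewrite divr_ge0// ltW//; lra.
have : e / 18 * (9 - 4 * (s / (d / 2))) <= e / 18 * 9.
  by rewrite ler_pM2l ?divr_gt0//; lra.
by lra.
Qed.

Definition leb_pt f t := forall e, 0 < e -> exists2 d, 0 < d &
     forall r, 0 < r < d -> Int (fun x => `|f x - f t| * sball t r x) <= e * r.

Lemma lebesgue_pt_leb_pt f t : meas f -> lebesgue_pt f t -> leb_pt f t.
Proof.
move=> mf /fine_cvgP[nf cf] e e0.
move/cvgr0_norm_lt: cf => /(_ _ (divr_gt0 e0 (ltr0n _ 2))) ce.
have [d /= d0 hd] := filterI nf ce.
exists d => // r /andP[r0 rd].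
have [|h1 h2] := hd r _ r0; first by rewrite /= sub0r normrN gtr0_norm.
move: h1 h2; rewrite /davg /iavg (lebesgue_measure_ball _ (ltW r0)).
rewrite inver gt_eqF ?mulrn_wgt0// => h1 h2.
have -> : Int (fun x => `|f x - f t| * sball t r x) =
    fine (\int[mu]_(y in ball t r) `|((center (f t) \o f) y)%:E|)%E.
  rewrite /Int /Rintegral [in RHS]integral_mkcond; congr fine; apply: eq_integral => x _.
  rewrite patchE /sball indicE; case: ifPn => _; rewrite ?mulr1 ?mulr0//=.
move: h1 h2; case: (\int[mu]_(y in ball t r) _)%E => [z| |] /=.
- move=> _ h; have r2 : 0 < r *+ 2 by rewrite mulrn_wgt0.
  have : `|(r *+ 2)^-1 * z| < e / 2 by [].
  rewrite normrM gtr0_norm ?invr_gt0// mulrC ltr_pdivrMr// => hz.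
  by apply: (le_trans (ler_norm _)); apply: ltW; apply: (lt_le_trans hz); rewrite -mulr_natr; lra.
- by rewrite mulry gtr0_sg ?invr_gt0 ?mulrn_wgt0// mul1e.
- by rewrite mulrNy gtr0_sg ?invr_gt0 ?mulrn_wgt0// mul1e.
Qed.

Lemma ae_leb_pt f : meas f -> (forall a b : R, \int[mu]_(x in `[a, b]) `|(f x)%:E| < +oo)%E ->
  {ae mu, forall t, leb_pt f t}.
Proof.
move=> mf fi.
have li : locally_integrable [set: R] f.
  split; [exact: mf|exact: openT|move=> K _ cK].
  have [M hM] := compact_bounded cK.
  have [a Ka] : exists a, K `<=` `[- a, a]%classic.
    exists (`|M| + 1) => x Kx /=; rewrite in_itv/= -ler_norml.
    apply: hM.2 => //; apply: (le_lt_trans (ler_norm _)); lra.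
  apply: le_lt_trans (fi (- a) a); apply: ge0_subset_integral => //.
  - exact: compact_measurable.
  - by apply/measurable_EFinP; apply: measurableT_comp => //; exact: measurable_funTS.
by apply: (aeS (lebesgue_differentiation li)) => t; exact: lebesgue_pt_leb_pt.
Qed.

(** The principal value kernel 1/u truncated at distance s; it vanishes on the closed interval that
    [hilbert_trunc] removes. *)
Definition tk (s u : R) : R := if `|u| <= s then 0 else u^-1.

Lemma meas_tk s : meas (tk s).
Proof.
apply: measurable_fun_ifT => //.
  by apply: measurable_fun_ler => //; exact: normr_measurable.
exact: measurable_funV.
Qed.

(** For |u| <= s the difference is |u| / (u^2 + s^2); beyond, it is s^2 / (|u| (u^2 + s^2)). Sharp
    truncation and smooth regularisation therefore differ by a Poisson average. *)
Lemma tk_qk (s u : R) : 0 < s -> `|tk s u - qk s u| <= pk s u.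
Proof.
move=> s0; have D0 := den_gt0 u s0; rewrite /tk /qk /pk.
have [us|us] := leP `|u| s.
  rewrite sub0r normrN normrM [X in _ * X]gtr0_norm ?invr_gt0//.
  by rewrite ler_wpM2r// invr_ge0 ltW.
have u0 : 0 < `|u| by exact: lt_trans us.
have un : u != 0 by rewrite -normr_gt0.
have -> : u^-1 - u / (u ^+ 2 + s ^+ 2) = u^-1 * s * (s / (u ^+ 2 + s ^+ 2)).
  by field; rewrite un gt_eqF.
rewrite normrM [X in _ * X]gtr0_norm ?divr_gt0//; apply: ler_piMl.
  by rewrite divr_ge0 ?(ltW s0) ?(ltW D0).
by rewrite normrM normfV (gtr0_norm s0) mulrC ler_pdivrMr// mul1r ltW.
Qed.

Lemma tkN (s u : R) : tk s (- u) = - tk s u.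
Proof. by rewrite /tk normrN; case: ifP; rewrite ?oppr0// invrN. Qed.

(** The difference is odd about [t]. Hence the constant [f t] can be subtracted from [f] for free,
    which brings in the Lebesgue point condition. *)
Lemma Int_tkqk (s t : R) : 0 < s ->
  intg (fun x => tk s (x - t) - qk s (x - t)) /\
  Int (fun x => tk s (x - t) - qk s (x - t)) = 0.
Proof.
move=> s0.
have msh k : meas k -> meas (fun x => k (x - t)).
  by move=> mk; apply: (measurableT_comp mk); exact: measurable_funB.
have i : intg (fun x => tk s (x - t) - qk s (x - t)).
  apply: (@intg_le _ _ (fun x => pk s (t - x))).
  - by apply: measurable_funB; apply: msh; [exact: meas_tk|exact: meas_qk].
  - by have [] := Int_pk_shift t s0.
  - by move=> x; rewrite pkB; exact: tk_qk.
split=> //; apply: (Int_odd (c := t + t) i) => x.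
by rewrite (_ : t + t - x - t = - (x - t)) ?tkN ?qkN; ring.
Qed.

Lemma leb_pt_pk f t : meas f -> intg (fun x => f x * pk 1 (x - t)) -> leb_pt f t ->
  forall e, 0 < e -> exists2 d, 0 < d & forall s, 0 < s < d ->
    [/\ intg (fun x => `|f x - f t| * pk s (x - t)),
       intg (fun x => f x * pk s (x - t)) & Int (fun x => `|f x - f t| * pk s (x - t)) <= e].
Proof.
move=> mf fi lf e e0.
have ip s : 0 < s -> intg (fun x => pk s (x - t)).
  move=> s0; apply: (eq_intg _ (Int_pk_shift t s0).1) => x; exact: pkB.
have mm : meas (fun x => `|f x - f t|).
  by apply: measurableT_comp => //; exact: measurable_funB.
have [|||d d0 hd] := @poisson_lebesgue_pt (fun x => `|f x - f t|) t _ _ _ lf e e0.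
- exact: mm.
- by [].
- apply: (@intg_le _ _ (fun x => `|f x * pk 1 (x - t)| + `|f t| * pk 1 (x - t))).
  + apply: measurable_funM; first exact: mm.
    exact: intg_meas (ip 1 ltr01).
  + by apply: intgD; [exact: intg_abs|apply: intgZ; exact: ip].
  + move=> x; have p0 := pk_ge0 (x - t) (@ltr01 R).
    rewrite (normrM (f x)) (normrM `|_ - _|) (ger0_norm p0) normr_id -mulrDl ler_wpM2r//.
    exact: ler_normB.
exists d => // s sd; have [h1 h2] := hd s sd; split=> //.
have s0 : 0 < s by case/andP: sd.
apply: (@intg_le _ _ (fun x => `|f x - f t| * pk s (x - t) + `|f t| * pk s (x - t))).
- by apply: measurable_funM; [exact: mf|exact: intg_meas (ip s s0)].
- by apply: intgD => //; apply: intgZ; exact: ip.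
move=> x; rewrite (normrM (f x)) -mulrDl (ger0_norm (pk_ge0 _ s0)) ler_wpM2r ?pk_ge0//.
by rewrite -lerBlDr lerB_dist.
Qed.

End LebesguePoint.

(** * Almost everywhere and L^2 limits *)

Section L2limit.
Variable R : realType.
Notation mu := (@lebesgue_measure R).
Implicit Types f g : R -> R.

Lemma L2_fatou (u : nat -> R -> R) g h C : (forall n, meas (u n)) -> meas g -> meas h ->
  {ae mu, forall t, u n t @[n --> \oo] --> g t} ->
  (forall n, intg (fun x => (h x - u n x) ^+ 2) /\ Int (fun x => (h x - u n x) ^+ 2) <= C) ->
  intg (fun x => (h x - g x) ^+ 2) /\ Int (fun x => (h x - g x) ^+ 2) <= C.
Proof.
move=> mu_ mg mh ug hC.
have mhu n : meas (fun x => (h x - u n x) ^+ 2).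
  by apply: measurable_funX; apply: measurable_funB; [exact: mh|exact: mu_].
have mhg : meas (fun x => (h x - g x) ^+ 2).
  by apply: measurable_funX; exact: measurable_funB.
have le : (\int[mu]_x ((h x - g x) ^+ 2)%:E <= C%:E)%E.
  have [N [mN N0 hN]] := ug.
  (* The exceptional null set is cut out so that the lower limit in Fatou's lemma can be computed at
     every point. *)
  pose h' m x := (h x - u m x) ^+ 2 * \1_(~` N) x.
  have mN' : meas (\1_(~` N) : R -> R) by apply: measurable_indic; exact: measurableC.
  have mh' m : meas (h' m) by apply: measurable_funM; [exact: mhu|exact: mN'].
  have h'0 m x : 0 <= h' m x by rewrite mulr_ge0 ?sqr_ge0// indicE; case: (_ \in _).
  have h'le m x : h' m x <= (h x - u m x) ^+ 2.
    by rewrite ler_piMr ?sqr_ge0// indicE; case: (_ \in _).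
  have lim x : limn_einf (fun m => (h' m x)%:E) = ((h x - g x) ^+ 2 * \1_(~` N) x)%:E.
    have c : (h' n x)%:E @[n --> \oo] --> ((h x - g x) ^+ 2 * \1_(~` N) x)%:E.
      apply: cvg_EFin; first exact: nearW.
      rewrite /=; have [Nx|nNx] := pselect (N x).
        rewrite indicE memNset ?mulr0; last by apply.
        rewrite (_ : _ \o _ = fun=> 0); first exact: cvg_cst.
        by apply/funext => n; rewrite /= /h' indicE memNset ?mulr0//; apply.
      rewrite indicE mem_set// mulr1 (_ : _ \o _ = fun n => (h x - u n x) * (h x - u n x)).
        have ux : u n x @[n --> \oo] --> g x by apply: contrapT => nc; apply: nNx; exact: hN.
        by rewrite expr2; apply: cvgM; apply: cvgB => //; exact: cvg_cst.
      by apply/funext => n; rewrite /= /h' indicE mem_set// mulr1 expr2.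
    by have [] := cvg_limn_einf_sup c.
  rewrite (@ge0_ae_eq_integral _ _ _ mu setT _ (fun x => ((h x - g x) ^+ 2 * \1_(~` N) x)%:E)) //; first last.
  - exists N; split=> // x /= nx; apply: contrapT => nNx; apply: nx => _.
    by rewrite indicE mem_set// mulr1.
  - by move=> x _; rewrite lee_fin mulr_ge0 ?sqr_ge0// indicE; case: (_ \in _).
  - by move=> x _; rewrite lee_fin sqr_ge0.
  - by apply/measurable_EFinP; exact: measurable_funM.
  - exact/measurable_EFinP.
  under eq_integral do rewrite -lim.
  apply: (le_trans (@fatou _ _ _ mu setT measurableT (fun n x => (h' n x)%:E) _ _)).
  - by move=> n; apply/measurable_EFinP; exact: mh'.
  - by move=> n x _; rewrite lee_fin.
  rewrite limn_einf_lim; apply: lime_le; first exact: is_cvg_einfs.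
  apply: nearW => n; apply: (@le_trans _ _ (\int[mu]_x (h' n x)%:E)%E).
    by apply: ereal_inf_lbound; exists n => /=.
  have [i l] := hC n; have ih : intg (h' n).
    by apply: (intg_le _ i) => // x; rewrite ger0_norm.
  by rewrite -EFin_Int// lee_fin; apply: le_trans l; exact: Int_le.
have i : intg (fun x => (h x - g x) ^+ 2).
  apply: intg_ge0P => //; first by move=> x; exact: sqr_ge0.
  by apply: le_lt_trans le _; rewrite ltry.
by split=> //; rewrite -lee_fin EFin_Int.
Qed.

Lemma cvg_of_geometric (u : nat -> R) B : (forall n, `|u n.+1 - u n| <= B * 2^-1 ^+ n) ->
  cvgn u.
Proof.
move=> h.
have : cvgn (series (fun n => u n.+1 - u n)).
  apply: normed_cvg; apply: (@series_le_cvg _ _ (geometric B 2^-1)).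
  - by move=> n /=.
  - by move=> n; exact: le_trans (h n).
  - by move=> n; exact: h.
  - by apply: is_cvg_geometric_series; rewrite gtr0_norm; lra.
move=> c; have -> : u = (fun n => series (fun n => u n.+1 - u n) n + u 0).
  apply/funext => n; elim: n => [|n IH]; first by rewrite /series /= big_geq// add0r.
  by rewrite seriesSr -addrA [_ + u 0]addrC addrA -IH addrC subrK.
by apply: is_cvgD => //; exact: is_cvg_cst.
Qed.

(** A Riesz-Fischer argument for a sequence with rate 8^-n, fast enough for the whole sequence to
    converge almost everywhere. *)
Lemma L2_complete (u : nat -> R -> R) : (forall n, meas (u n)) ->
  (forall n m, (n <= m)%N -> intg (fun x => (u n x - u m x) ^+ 2) /\
     Int (fun x => (u n x - u m x) ^+ 2) <= 8^-1 ^+ n) ->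
  exists g, [/\ meas g, {ae mu, forall t, u n t @[n --> \oo] --> g t} &
    forall n, intg (fun x => (u n x - g x) ^+ 2) /\ Int (fun x => (u n x - g x) ^+ 2) <= 8^-1 ^+ n].
Proof.
move=> mu_ hu.
(* With the weight 4^n the integrals are at most 2^-n, so the sum [S] is integrable. Where [S] is
   finite, consecutive terms differ by at most sqrt S times 2^-n. *)
pose d n x := 4 ^+ n * (u n x - u n.+1 x) ^+ 2.
have d0 n x : 0 <= d n x by apply: mulr_ge0; [rewrite exprn_ge0|exact: sqr_ge0].
have md n : meas (d n).
  by apply: measurable_funM => //; apply: measurable_funX; apply: measurable_funB; exact: mu_.
pose S x := (\sum_(0 <= n <oo) (d n x)%:E)%E.
have iS : mu.-integrable setT S.
  apply/integrableP; split.
    by apply: ge0_emeasurable_sum => n; [move=> *; rewrite lee_fin|move=> _; apply/measurable_EFinP; exact: md].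
  have S0 x : (0 <= S x)%E by apply: nneseries_ge0 => n _ _; rewrite lee_fin.
  under eq_integral do rewrite gee0_abs//.
  rewrite /S integral_nneseries//; last 2 first.
  - by move=> n; apply/measurable_EFinP; exact: md.
  - by move=> n x _; rewrite lee_fin.
  apply: (@le_lt_trans _ _ (\sum_(0 <= n <oo) (2^-1 ^+ n : R)%:E)%E).
    apply: lee_nneseries => [n _ _|n _]; first by apply: integral_ge0 => x _; rewrite lee_fin.
    have [i l] := hu n n.+1 (leqnSn n).
    rewrite -EFin_Int; last exact: intgZ.
    rewrite lee_fin IntZ//; apply: (@le_trans _ _ (4 ^+ n * 8^-1 ^+ n)).
      by rewrite ler_wpM2l ?exprn_ge0.
    rewrite -exprMn le_eqVlt; apply/orP; left; apply/eqP; congr (_ ^+ _); lra.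
  apply: (@le_lt_trans _ _ 2%:E); last by rewrite ltry.
  apply: lime_le.
    by apply: is_cvg_nneseries => n _ _; rewrite lee_fin exprn_ge0.
  apply: nearW => n; rewrite sumEFin lee_fin.
  suff -> : \sum_(0 <= k < n) 2^-1 ^+ k = 2 - 2 * 2^-1 ^+ n :> R.
    by rewrite lerBlDr lerDl mulr_ge0// exprn_ge0.
  elim: n => [|n IH]; first by rewrite big_geq// expr0; lra.
  by rewrite big_nat_recr//= IH exprS; lra.
have [N [mN N0 hN]] := integrable_ae measurableT iS.
have cN x : ~ N x -> cvgn (fun n => u n x).
  move=> nN; have Sx : S x \is a fin_num.
    by apply: contrapT => nf; apply: nN; apply: hN => /(_ I).
  apply: (@cvg_of_geometric _ (Num.sqrt (fine (S x)))) => n.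
  have h : d n x <= fine (S x).
    rewrite -lee_fin fineK//.
    have pos k : (0 <= (d k x)%:E)%E by rewrite lee_fin.
    apply: le_trans (@nneseries_lim_ge _ _ xpredT 0 n.+1 (fun k _ _ => pos k)).
    rewrite big_nat_recr//= leeDr// sume_ge0// => k _; by rewrite lee_fin.
  have p4 : 0 < 4 ^+ n :> R by rewrite exprn_gt0.
  rewrite -sqrtr_sqr -(ler_pM2r (exprn_gt0 n (ltr0n R 2))) -mulrA -exprMn mulVf// expr1n mulr1.
  have -> : (2:R) ^+ n = Num.sqrt (4 ^+ n).
    rewrite -[LHS]ger0_norm ?exprn_ge0// -sqrtr_sqr; congr Num.sqrt.
    by rewrite -exprM mulnC exprM; congr (_ ^+ _); ring.
  rewrite -sqrtrM ?sqr_ge0//.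
  have -> : (u n.+1 x - u n x) ^+ 2 * 4 ^+ n = d n x by rewrite /d; ring.
  by rewrite ler_sqrt// (le_trans _ h).
(* Setting the sequence to 0 on [N] makes it converge everywhere, so the limit is measurable. *)
pose v n x := u n x * \1_(~` N) x.
pose g x := limn (fun n => v n x).
have vE n x : ~ N x -> v n x = u n x by move=> nN; rewrite /v indicE mem_set// mulr1.
have vg x : v n x @[n --> \oo] --> g x.
  have [Nx|nNx] := pselect (N x); last first.
    have h : v ^~ x = u ^~ x by apply/funext => n; rewrite vE.
    by rewrite /g h; exact: cN.
  have h : v ^~ x = (fun=> 0).
    by apply/funext => n; rewrite /v indicE memNset ?mulr0//=; apply.
  by rewrite /g h; exact: (is_cvg_cst (0:R)).
have mg : meas g.
  apply: (@measurable_fun_cvg _ _ _ _ v) => // n.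
  by apply: measurable_funM; [exact: mu_|apply: measurable_indic; exact: measurableC].
have ug : {ae mu, forall t, u n t @[n --> \oo] --> g t}.
  exists N; split=> // x /= h; apply: contrapT => nNx; apply: h.
  have e : u ^~ x = v ^~ x by apply/funext => n; rewrite vE.
  by rewrite e; exact: vg.
exists g; split=> // n.
apply: (@L2_fatou (fun m => u (n + m)%N)) => //.
- apply: (aeS ug) => t; move/(cvg_comp _ _ (cvg_addnl n)); exact.
- by move=> m; exact: hu (leq_addr _ _).
Qed.
End L2limit.

(** * The transform as an L^2 limit, and its energy on (-1, 1) *)

Section Hilbert.
Variable R : realType.
Notation mu := (@lebesgue_measure R).
Implicit Types f g k : R -> R.
Let I := @I11 R.

Lemma pk_avg f s t : 0 < s -> intg (fun x => f x * pk s (x - t)) ->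
  intg (fun x => `|f x - f t| * pk s (x - t)) ->
  `|Int (fun x => f x * pk s (x - t)) - pi * f t| <= Int (fun x => `|f x - f t| * pk s (x - t)).
Proof.
move=> s0 i1 i2; have [ip Ip] := Int_pk_shift t s0.
have e : (fun x => pk s (t - x)) =1 (fun x => pk s (x - t)) by move=> x; exact: pkB.
have jp := eq_intg e ip; rewrite (eq_Int e) in Ip.
rewrite -Ip mulrC -(IntZ _ jp) -(IntB i1 (intgZ _ jp)).
have i3 := intgB i1 (intgZ (f t) jp).
apply: (le_trans (Int_abs i3)); apply: Int_le => //; first exact: intg_abs.
by move=> x; rewrite -mulrBl (normrM (_ - _)) [X in _ * X <= _]ger0_norm// pk_ge0.
Qed.

Lemma Pf_leb M f t : bsupp M f -> leb_pt f t -> forall e, 0 < e ->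
  exists2 d, 0 < d & forall s, 0 < s < d -> `|Pf f s t - pi * f t| <= e.
Proof.
move=> bf lf e e0.
have [d d0 hd] := leb_pt_pk bf.1 ((sqdom_conv bf (sqdom_pk ltr01)).1 t) lf e0.
exists d => // s sd; have [h1 h2 h3] := hd s sd; apply: le_trans h3.
by apply: pk_avg => //; case/andP: sd.
Qed.

Lemma bsupp_leb M f : bsupp M f -> {ae mu, forall t, leb_pt f t}.
Proof.
move=> bf; apply: ae_leb_pt; first exact: bf.1.
move=> a b; have /integrableP[_] := bsupp_intg bf; apply: le_lt_trans.
apply: ge0_subset_integral => //=.
by apply/measurable_EFinP; apply: measurableT_comp => //; exact: bf.1.
Qed.

Lemma Pf_bound M f s t : bsupp M f -> 0 < s -> `|Pf f s t| <= M * pi.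
Proof.
move=> bf s0; have M0 := bsupp_ge0 bf; have [ip Ip] := Int_pk_shift t s0.
have i1 := (sqdom_conv bf (sqdom_pk s0)).1 t.
apply: (le_trans (Int_abs i1)); rewrite -Ip -(IntZ _ ip).
apply: Int_le; [exact: intg_abs|exact: intgZ|].
move=> x; rewrite pkB (normrM (f x)) [X in _ * X <= _]ger0_norm ?pk_ge0//.
by rewrite ler_wpM2r ?pk_ge0//; exact: bsupp_bnd bf.
Qed.

Lemma bsupp_sqr M f : bsupp M f -> bsupp (M ^+ 2) (fun x => f x ^+ 2).
Proof.
move=> bf; have M0 := bsupp_ge0 bf; split; first exact: measurable_funX bf.1.
move=> x; have [Ix|nIx] := pselect (I x); last first.
  by rewrite (bsupp_out bf nIx) expr0n normr0 mulr_ge0 ?sqr_ge0 ?indicI_ge0.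
rewrite indicE mem_set// mulr1 normrX ler_sqr ?nnegrE//; exact: bsupp_bnd bf.
Qed.

Lemma right_cvg_seq (F : R -> R) l :
  (forall y : nat -> R, (forall n, 0 < y n) -> y n @[n --> \oo] --> 0 -> F (y n) @[n --> \oo] --> l) ->
  forall e, 0 < e -> exists2 d, 0 < d & forall s, 0 < s < d -> `|F s - l| <= e.
Proof.
move=> h e e0.
have : F x @[x --> 0^'+] --> l.
  by apply/cvg_at_rightP => u [u0 ul]; exact: h.
move/cvgr_dist_le => /(_ _ e0) [d /= d0 hd].
exists d => // s /andP[s0 sd]; rewrite distrC; apply: hd => //=.
by rewrite sub0r normrN gtr0_norm.
Qed.

(** [Pf f s] tends to [pi * f] at Lebesgue points of [f] and stays below [M * pi], so dominated
    convergence applies along every sequence of heights. *)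
Lemma energy_lim M f : bsupp M f -> forall e, 0 < e -> exists2 d, 0 < d &
  forall s, 0 < s < d -> `|Int (fun x => f x * Pf f s x) - pi * Int (fun x => f x ^+ 2)| <= e.
Proof.
move=> bf; have M0 := bsupp_ge0 bf; have isq := bsupp_intg (bsupp_sqr bf).
apply: right_cvg_seq => y y0 yl.
rewrite -(IntZ _ isq).
have sP n := (sqdom_conv bf (sqdom_pk (y0 n))).2.
have [|||||_ //] := @Int_dct R (fun n x => f x * Pf f (y n) x) (fun x => pi * f x ^+ 2) (fun x => M * (M * pi) * \1_I x).
- by move=> n; apply: measurable_funM; [exact: bf.1|exact: (sP n).1].
- by apply: measurable_funM => //; exact: measurable_funX bf.1.
- apply: (aeS (bsupp_leb bf)) => t lt.
  rewrite (_ : pi * f t ^+ 2 = f t * (pi * f t)); last by ring.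
  apply: cvgM; first exact: cvg_cst.
  apply/cvgrPdist_le => e e0; have [d d0 hd] := Pf_leb bf lt e0.
  move/cvgr0_norm_lt : yl => /(_ _ d0); apply: filterS => n yn.
  by rewrite distrC; apply: hd; rewrite y0 -[ltLHS]gtr0_norm.
- by apply: intgZ; exact: intgI.
move=> n x; have [Ix|nIx] := pselect (I x); last first.
  rewrite (bsupp_out bf nIx) mul0r normr0 !mulr_ge0 ?indicI_ge0//; exact: pi_ge0.
rewrite indicE mem_set// mulr1 normrM; apply: ler_pM => //; first exact: bsupp_bnd bf.
exact: Pf_bound.
Qed.

(** Running minimum of the thresholds, capped at 1: it makes the heights chosen in [seq_lim]
    decrease. *)
Fixpoint runmin (d : nat -> R) n :=
  if n is m.+1 then Num.min (runmin d m) (d n) else Num.min 1 (d 0).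

Lemma runmin_gt0 (d : nat -> R) (n : nat) : (forall m : nat, 0 < d m) -> 0 < runmin d n.
Proof. by move=> d0; elim: n => [|n IH] /=; rewrite lt_min ?IH d0 ?ltr01. Qed.

Lemma runmin_le d n m : (n <= m)%N -> runmin d m <= runmin d n.
Proof.
move=> /subnK <-; elim: (m - n)%N => [|k IH] //=.
by rewrite ge_min IH.
Qed.

Lemma runmin_le1 d n : runmin d n <= 1.
Proof. by apply: (le_trans (runmin_le _ (leq0n n))); rewrite /= ge_min lexx. Qed.

Lemma runmin_led d n : runmin d n <= d n.
Proof. by case: n => [|n] /=; rewrite ge_min lexx orbT. Qed.

(** [y n + y n], [y m + y m] and [y n + y m] are the arguments in the second difference of
    [QP_diff]. *)
Lemma seq_lim (E : R -> R) l (a : nat -> R) : (forall n, 0 < a n) ->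
  (forall e, 0 < e -> exists2 d, 0 < d & forall s, 0 < s < d -> `|E s - l| <= e) ->
  exists y : nat -> R, [/\ forall n, 0 < y n, y n @[n --> \oo] --> 0 &
    forall n m, (n <= m)%N -> [/\ `|E (y n + y n) - l| <= a n, `|E (y m + y m) - l| <= a n
      & `|E (y n + y m) - l| <= a n]].
Proof.
move=> a0 El.
have /choice[d hd] : forall n, exists d, 0 < d /\ forall s, 0 < s < d -> `|E s - l| <= a n.
  by move=> n; have [d d0 h] := El _ (a0 n); exists d.
have d0 n : 0 < d n by have [] := hd n.
(* Dividing by 3 keeps the sum of two heights below [d n]; the factor 1/(n + 1) forces the limit
   0. *)
pose y n := runmin d n / 3 * n.+1%:R^-1.
have y0 n : 0 < y n by rewrite mulr_gt0 ?divr_gt0 ?runmin_gt0 ?invr_gt0.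
have yle n m : (n <= m)%N -> y m <= y n.
  move=> nm; apply: ler_pM; rewrite ?divr_ge0 ?invr_ge0 ?(ltW (runmin_gt0 _ d0))//.
    by rewrite ler_pM2r ?invr_gt0//; exact: runmin_le.
  by rewrite lef_pV2 ?posrE// ler_nat.
have yd n : y n <= d n / 3.
  rewrite /y; apply: (@le_trans _ _ (runmin d n / 3)).
    by rewrite ler_piMr ?divr_ge0 ?(ltW (runmin_gt0 _ d0))// invf_le1// ler1n.
  by rewrite ler_pM2r ?invr_gt0//; exact: runmin_led.
exists y; split=> //.
  apply: (@squeeze_cvgr _ _ _ _ (fun=> 0) (@harmonic R)); last 2 first.
  - exact: cvg_cst.
  - exact: cvg_harmonic.
  apply: nearW => n; rewrite (ltW (y0 n))/= /harmonic /= ler_piMl//.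
  by have := runmin_le1 d n; lra.
move=> n m nm; have := yd n; have := yle n m nm; have := y0 n; have := y0 m => ? ? ? ?.
by have [_ h] := hd n; split; apply: h; apply/andP; split; lra.
Qed.

(** Expanding the squares with [QP_energy] gives a second difference of the pairing of f with P_s.
    As this pairing converges when s tends to 0, both Q and P are Cauchy in L^2. *)
Lemma QP_diff M f y w : bsupp M f -> 0 < y -> 0 < w ->
  [/\ intg (fun t => (Qf f y t - Qf f w t) ^+ 2), intg (fun t => (Pf f y t - Pf f w t) ^+ 2) &
  Int (fun t => (Qf f y t - Qf f w t) ^+ 2) + Int (fun t => (Pf f y t - Pf f w t) ^+ 2) =
  2 * pi * (Int (fun x => f x * Pf f (y + y) x) + Int (fun x => f x * Pf f (w + w) x)
     - 2 * Int (fun x => f x * Pf f (y + w) x))].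
Proof.
move=> bf y0 w0.
have sQy := (sqdom_conv bf (sqdom_qk y0)).2; have sPy := (sqdom_conv bf (sqdom_pk y0)).2.
have sQw := (sqdom_conv bf (sqdom_qk w0)).2; have sPw := (sqdom_conv bf (sqdom_pk w0)).2.
have key k1 k2 C1 C2 : sqdom C1 k1 -> sqdom C2 k2 -> intg (fun t => (k1 t - k2 t) ^+ 2).
  move=> s1 s2; apply: (@eq_intg _ (fun t => (k1 t * k1 t + k2 t * k2 t) - 2 * (k1 t * k2 t))).
    by move=> t; ring.
  apply: intgB; first by apply: intgD; [exact: (intg_mul_sqdom s1 s1)|exact: (intg_mul_sqdom s2 s2)].
  by apply: intgZ; exact: (intg_mul_sqdom s1 s2).
have iQ := key _ _ _ _ sQy sQw; have iP := key _ _ _ _ sPy sPw; split=> //.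
have e1 := QP_energy bf y0 y0; have e2 := QP_energy bf w0 w0; have e3 := QP_energy bf y0 w0.
have alg (A B C D1 D2 D3 X : R) : D1 = 2 * pi * A -> D2 = 2 * pi * B -> D3 = 2 * pi * C ->
  X = D1 + D2 - 2 * D3 -> X = 2 * pi * (A + B - 2 * C).
  by move=> -> -> -> ->; ring.
apply: (alg _ _ _ _ _ _ _ e1 e2 e3); move: {alg e1 e2 e3 key} sQy sPy sQw sPw iQ iP.
rewrite /Qf /Pf; move: (conv f (qk y)) (conv f (pk y)) (conv f (qk w)) (conv f (pk w)).
move=> a b c d sa sb sc sd iQ iP.
have j1 := intgD (intg_mul_sqdom sa sa) (intg_mul_sqdom sb sb).
have j2 := intgD (intg_mul_sqdom sc sc) (intg_mul_sqdom sd sd).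
have j3 := intgD (intg_mul_sqdom sa sc) (intg_mul_sqdom sb sd).
rewrite -(IntD iQ iP) -(IntD j1 j2) -(IntZ _ j3) -(IntB (intgD j1 j2) (intgZ 2 j3)).
by apply: eq_Int => t; ring.
Qed.

Lemma cvg_dist_geometric (u : nat -> R) l K : (forall n, `|u n - l| <= K * 2^-1 ^+ n) ->
  u n @[n --> \oo] --> l.
Proof.
move=> h.
have c : K * 2^-1 ^+ n @[n --> \oo] --> 0.
  rewrite -(mulr0 K); apply: cvgM; first exact: cvg_cst.
  by apply: cvg_expr; rewrite gtr0_norm; lra.
apply/cvgrPdist_le => e e0; move/cvgr0_norm_le : c => /(_ _ e0).
apply: filterS => n hn; rewrite distrC.
exact: le_trans (h n) (le_trans (ler_norm _) hn).
Qed.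

(** Norm convergence tested against a square integrable [k]. The Cauchy-Schwarz inequality is
    replaced by a weighted arithmetic-geometric mean bound. *)
Lemma L2_weak (v : nat -> R -> R) g k : (forall n, meas (v n)) -> meas g -> meas k ->
  intg (fun x => k x ^+ 2) -> (forall n, intg (fun x => v n x * k x)) ->
  (forall n, intg (fun x => (v n x - g x) ^+ 2) /\ Int (fun x => (v n x - g x) ^+ 2) <= 8^-1 ^+ n) ->
  intg (fun x => g x * k x) /\ Int (fun x => v n x * k x) @[n --> \oo] --> Int (fun x => g x * k x).
Proof.
move=> mv mg mk ik iv hv.
pose K := Int (fun x => k x ^+ 2).
have p2 n : 0 < 2 ^+ n :> R by rewrite exprn_gt0.
(* Against the rate 8^-n the weight 2^n leaves 4^-n / 2, while the second term contributes 2^-n K /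
   2: both are summable errors. *)
pose B n x := 2 ^+ n / 2 * (v n x - g x) ^+ 2 + 2^-1 ^+ n / 2 * k x ^+ 2.
have iB n : intg (B n) by apply: intgD; apply: intgZ => //; have [] := hv n.
have leB n x : `|(v n x - g x) * k x| <= B n x.
  rewrite /B exprVn; set p := 2 ^+ n.
  have pp : p * p^-1 = 1 by rewrite mulfV// gt_eqF// p2.
  have p0 : 0 < p := p2 n.
  rewrite normrM -(real_normK (num_real (v n x - g x))) -(real_normK (num_real (k x))).
  have := mulr_ge0 (ltW p0) (sqr_ge0 (`|v n x - g x| - p^-1 * `|k x|)).
  have -> : p * (`|v n x - g x| - p^-1 * `|k x|) ^+ 2 = p * `|v n x - g x| ^+ 2 -
    2 * (p * p^-1) * `|v n x - g x| * `|k x| + (p * p^-1) * p^-1 * `|k x| ^+ 2 by ring.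
  by rewrite pp; lra.
have id n : intg (fun x => (v n x - g x) * k x).
  apply: (intg_le _ (iB n) (leB n)); apply: measurable_funM => //.
  by apply: measurable_funB; [exact: mv|exact: mg].
have ig : intg (fun x => g x * k x).
  by apply: (@eq_intg _ (fun x => v 0%N x * k x - (v 0%N x - g x) * k x)); [move=> x; ring|exact: intgB].
split=> //; apply: (@cvg_dist_geometric _ _ (1 + K)) => n.
rewrite -(IntB (iv n) ig) (@eq_Int _ _ (fun x => (v n x - g x) * k x)); last by move=> x; ring.
apply: (le_trans (Int_abs (id n))); apply: (@le_trans _ _ (Int (B n))).
  by apply: Int_le => //; exact: intg_abs.
have [h1 h2] := hv n; rewrite /B IntD; [|exact: intgZ|exact: intgZ].
rewrite !IntZ// -/K.
have K0 : 0 <= K by apply: Int_ge0 => x; exact: sqr_ge0.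
have : 2 ^+ n / 2 * Int (fun x => (v n x - g x) ^+ 2) <= 2 ^+ n / 2 * 8^-1 ^+ n.
  by rewrite ler_pM2l// divr_gt0.
have : 2 ^+ n * 8^-1 ^+ n <= 2^-1 ^+ n :> R.
  by rewrite -exprMn lerXn2r ?nnegrE//; lra.
have : 0 <= 2^-1 ^+ n * K by rewrite mulr_ge0// exprn_ge0.
have : 0 <= 2^-1 ^+ n :> R by rewrite exprn_ge0.
by lra.
Qed.

Lemma qk_bound (y u : R) : 0 < y -> `|qk y u| <= y^-1.
Proof.
move=> y0; rewrite /qk normrM normfV (gtr0_norm (den_gt0 u y0)).
rewrite ler_pdivrMr ?den_gt0// mulrC ler_pdivlMr//.
rewrite -(real_normK (num_real u)).
by have := sqr_ge0 (`|u| - y); have := normr_ge0 u; nra.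
Qed.

Lemma Qf_cvg M f (y : nat -> R) s t : bsupp M f -> 0 < s -> (forall n, 0 < y n) ->
  y n @[n --> \oo] --> 0 -> Qf f (s + y n) t @[n --> \oo] --> Qf f s t.
Proof.
move=> bf s0 y0 yl; have M0 := bsupp_ge0 bf.
have msh (k : R -> R) : meas k -> meas (fun x => k (x - t)).
  by move=> mk; apply: (measurableT_comp mk); exact: measurable_funB.
have [|||||_ //] := @Int_dct R (fun n x => f x * qk (s + y n) (x - t))
  (fun x => f x * qk s (x - t)) (fun x => M * s^-1 * \1_I x).
- by move=> n; apply: measurable_funM; [exact: bf.1|apply: msh; exact: meas_qk].
- by apply: measurable_funM; [exact: bf.1|apply: msh; exact: meas_qk].
- apply: aeW => x; apply: cvgM; first exact: cvg_cst.
  rewrite /qk; apply: cvgM; first exact: cvg_cst.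
  apply: cvgV; first by rewrite gt_eqF ?den_gt0.
  apply: cvgD; first exact: cvg_cst.
  under eq_fun do rewrite expr2; rewrite expr2.
  have sy : s + y n @[n --> \oo] --> s.
    by rewrite -[X in _ --> X]addr0; apply: cvgD => //; exact: cvg_cst.
  exact: cvgM.
- by apply: intgZ; exact: intgI.
move=> n x; have [Ix|nIx] := pselect (I x); last first.
  by rewrite (bsupp_out bf nIx) mul0r normr0 !mulr_ge0 ?indicI_ge0 ?invr_ge0 ?(ltW s0).
rewrite indicE mem_set// mulr1 (normrM (f x)); apply: ler_pM => //; first exact: bsupp_bnd bf.
have sy : 0 < s + y n by rewrite addr_gt0.
apply: (le_trans (qk_bound _ sy)); rewrite lef_pV2 ?posrE//.
by rewrite lerDl ltW.
Qed.

Lemma Int_tk_leb M f s t : bsupp M f -> 0 < s ->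
  intg (fun x => `|f x - f t| * pk s (x - t)) ->
  `|Int (fun x => f x * tk s (x - t)) - Qf f s t| <= Int (fun x => `|f x - f t| * pk s (x - t)).
Proof.
move=> bf s0 i1; have M0 := bsupp_ge0 bf; have [ik Ik] := Int_tkqk t s0.
have msh (k : R -> R) : meas k -> meas (fun x => k (x - t)).
  by move=> mk; apply: (measurableT_comp mk); exact: measurable_funB.
have iq := (sqdom_conv bf (sqdom_qk s0)).1 t.
have id : intg (fun x => (f x - f t) * (tk s (x - t) - qk s (x - t))).
  apply: (intg_le _ i1).
    apply: measurable_funM; first by apply: measurable_funB => //; exact: bf.1.
    exact: intg_meas ik.
  by move=> x; rewrite normrM ler_wpM2l//; exact: tk_qk.
have it : intg (fun x => f x * tk s (x - t)).
  apply: (@eq_intg _ (fun x => (f x - f t) * (tk s (x - t) - qk s (x - t))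
    + f t * (tk s (x - t) - qk s (x - t)) + f x * qk s (x - t))); first by move=> x; ring.
  by apply: intgD => //; apply: intgD => //; exact: intgZ.
rewrite /Qf /conv -(IntB it iq).
rewrite (@eq_Int _ _ (fun x => (f x - f t) * (tk s (x - t) - qk s (x - t))
    + f t * (tk s (x - t) - qk s (x - t)))); last by move=> x; ring.
rewrite (IntD id (intgZ _ ik)) (IntZ _ ik) Ik mulr0 addr0.
apply: (le_trans (Int_abs id)); apply: Int_le => //; first exact: intg_abs.
by move=> x; rewrite normrM ler_wpM2l//; exact: tk_qk.
Qed.

Lemma ae_leb_pt_L2 g : meas g -> intg (fun x => g x ^+ 2) -> {ae mu, forall t, leb_pt g t}.
Proof.
move=> mg ig; apply: ae_leb_pt => // a b.
have : intg (fun x => g x * \1_(`[a, b] : set R) x).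
  apply: (@intg_le _ _ (fun x => \1_(`[a, b] : set R) x + g x ^+ 2)).
  - by apply: measurable_funM => //; apply: measurable_indic; exact: measurable_itv.
  - by apply: intgD => //; exact: (@integrable_indic_itv R a b true false).
  move=> x; rewrite indicE; case: (_ \in _); last by rewrite mulr0 normr0 add0r sqr_ge0.
  rewrite mulr1 /= mulr1n -(real_normK (num_real (g x))).
  by have := sqr_ge0 (`|g x| - 1); have := sqr_ge0 `|g x|; nra.
move=> /integrableP[_]; apply: le_lt_trans.
rewrite integral_mkcond; apply: ge0_le_integral => //.
- by move=> x _; apply: erestrict_ge0.
- apply/(measurable_restrictT _ _).1 => //.
  by apply/measurable_funTS/measurable_EFinP; exact: measurableT_comp.
- by apply/measurable_EFinP; apply: measurableT_comp => //; apply: measurable_funM => //; apply: measurable_indic; exact: measurable_itv.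
by move=> x _; rewrite /= patchE indicE; case: (_ \in _); rewrite ?mulr1 ?mulr0 ?normr0.
Qed.

(** [Qf f s t] is the intermediate quantity: it is close to the truncated integral because [t] is a
    Lebesgue point of [f], and close to [g t] because pi times it is a Poisson average of [g]. *)
Lemma leb_pt_tk_cvg M f g t : bsupp M f -> meas g -> leb_pt f t -> leb_pt g t ->
  (forall s, 0 < s -> intg (fun x => g x * pk s (x - t)) /\
     Int (fun x => g x * pk s (x - t)) = pi * Qf f s t) ->
  Int (fun x => f x * tk s (x - t)) @[s --> 0^'+] --> g t.
Proof.
move=> bf mg lf lg hg; apply/cvgrPdist_le => e e0.
have e2 : 0 < e / 2 by rewrite divr_gt0.
have [d1 d10 h1] := leb_pt_pk bf.1 ((sqdom_conv bf (sqdom_pk ltr01)).1 t) lf e2.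
have [d2 d20 h2] := leb_pt_pk mg (hg 1 ltr01).1 lg e2.
near=> s.
have s0 : 0 < s by near: s; exact: nbhs_right_gt.
have [|i1 _ l1] := h1 s; first by rewrite s0; near: s; exact: nbhs_right_lt.
have [|i2 i2' l2] := h2 s; first by rewrite s0; near: s; exact: nbhs_right_lt.
have a1 := le_trans (Int_tk_leb bf s0 i1) l1.
have := le_trans (pk_avg s0 i2' i2) l2; rewrite (hg s s0).2 -mulrBr normrM.
have p1 : 1 <= pi :> R by apply: le_trans (@pi_ge2 R); rewrite ler1n.
rewrite gtr0_norm; last by apply: lt_le_trans p1.
move=> a2; have a3 : `|Qf f s t - g t| <= e / 2.
  by apply: le_trans a2; rewrite ler_peMl.
rewrite distrC -(subrKA (Qf f s t)) [leRHS]splitr.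
by apply: (le_trans (ler_normD _ _)); rewrite lerD.
Unshelve. all: by end_near.
Qed.

Lemma second_diff_le (A B C l d : R) : `|A - l| <= d -> `|B - l| <= d -> `|C - l| <= d ->
  A + B - 2 * C <= 4 * d.
Proof. rewrite !ler_norml => /andP[? ?] /andP[? ?] /andP[? ?]; lra. Qed.

(** Young's inequality with a free parameter: a small [h] keeps the main coefficient near 1, and the
    large factor falls on an error tending to 0. *)
Lemma sqr_le_split (h u v : R) : 0 < h ->
  u ^+ 2 <= (1 + h) * v ^+ 2 + (1 + h^-1) * (u - v) ^+ 2.
Proof.
move=> h0; have hh : h * h^-1 = 1 by rewrite mulfV// gt_eqF.
have := mulr_ge0 (ltW h0) (sqr_ge0 (v - h^-1 * (u - v))).
have -> : h * (v - h^-1 * (u - v)) ^+ 2 =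
  h * v ^+ 2 - 2 * (h * h^-1) * v * (u - v) + (h * h^-1) * h^-1 * (u - v) ^+ 2 by ring.
rewrite hh; move: (h^-1) => h'; nra.
Qed.

Lemma energy_sum_le (A p h h' G F b : R) : A <= (1 + h) * G + (1 + h') * p + b +
  ((1 + h) * F + (1 + h') * p) + p -> A <= (1 + h) * (G + F) + b + (3 + 2 * h') * p.
Proof. by move=> /le_trans; apply; lra. Qed.

Lemma scale_splitE (p q : R) : q != 0 -> p = 2 * q * (4 * (p / (8 * q))).
Proof. by move=> q0; field. Qed.

Lemma scale_split_le (p q : R) : 0 < p -> q != 0 -> 2 * q * (p / (8 * q)) <= p.
Proof.
move=> p0 q0; have -> : 2 * q * (p / (8 * q)) = p / 4 by field.
by rewrite ler_pdivrMr// ler_peMr ?(ltW p0)// ler1n.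
Qed.

(** Inside (-1, 1) the function is compared with its limit; outside, the decay bound is used, so
    only the energy of [g] inside the interval enters. *)
Lemma sqr_le_split_out (h q g k b x : R) : 0 < h -> 0 <= b -> 0 <= k -> (~ I x -> q ^+ 2 <= b * k) ->
  q ^+ 2 <= ((1 + h) * (g ^+ 2 * \1_I x) + (1 + h^-1) * (q - g) ^+ 2) + b * k.
Proof.
move=> h0 b0 k0 hq; have h1 : 0 <= 1 + h^-1 by rewrite addr_ge0// invr_ge0 ltW.
have [Ix|nIx] := pselect (I x).
  rewrite indicE mem_set// mulr1; apply: (le_trans (sqr_le_split q g h0)).
  by rewrite lerDl mulr_ge0.
rewrite indicE memNset// !mulr0 add0r; apply: (le_trans (hq nIx)).
by rewrite lerDr mulr_ge0// sqr_ge0.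
Qed.

Lemma energy_limit_le (p G F b e h X : R) : X = G + p * F -> h * X <= e / 2 ->
  2 * p * F <= X + h * X + b + e / 2 -> p * F <= G + b + e.
Proof. by move=> ->; lra. Qed.

Lemma sqr_le2 (u v : R) : v ^+ 2 <= 2 * (u * u) + 2 * (u - v) ^+ 2.
Proof. have := sqr_ge0 (2 * u - v); lra. Qed.

(** [g] is the principal value without the factor 1/pi. The last clause is the energy lower bound:
    decay of Q_y outside (-1, 1), uniform in y, limits the escaping energy to the integral of
    [b * pk 1], which is [b * pi]. *)
Lemma hilbert_L2 M f : bsupp M f -> exists g, [/\ meas g, intg (fun t => g t ^+ 2),
  {ae mu, forall t, Int (fun x => f x * tk s (x - t)) @[s --> 0^'+] --> g t} &
  forall b, 0 <= b -> (forall y t, 0 < y -> ~ I t -> Qf f y t ^+ 2 <= b * pk 1 t) ->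
    pi ^+ 2 * Int (fun x => f x ^+ 2) <= Int (fun t => g t ^+ 2 * \1_I t) + b * pi].
Proof.
move=> bf; have M0 := bsupp_ge0 bf.
have pi0 : 0 < pi :> R := pi_gt0 R.
have pn : (pi : R) != 0 by rewrite gt_eqF.
pose F := Int (fun x => f x ^+ 2).
have p8 n : 0 < 8^-1 ^+ n :> R by rewrite exprn_gt0.
(* The second difference is at most 4 [a n]; multiplied by 2 pi this is exactly 8^-n. *)
pose a (n : nat) : R := 8^-1 ^+ n / (8 * pi).
have a0 n : 0 < a n by rewrite divr_gt0 ?mulr_gt0.
have [y [y0 yl hy]] := seq_lim a0 (energy_lim bf).
have sQ n := (sqdom_conv bf (sqdom_qk (y0 n))).2.
have sP n := (sqdom_conv bf (sqdom_pk (y0 n))).2.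
have mQ n : meas (Qf f (y n)) := (sQ n).1.
have mP n : meas (Pf f (y n)) := (sP n).1.
have le_pi (u v : R) : u <= v -> 2 * pi * u <= 2 * pi * v by move=> uv; rewrite ler_pM2l ?mulr_gt0.
have QP n m : (n <= m)%N ->
    (intg (fun x => (Qf f (y n) x - Qf f (y m) x) ^+ 2) /\
     Int (fun x => (Qf f (y n) x - Qf f (y m) x) ^+ 2) <= 8^-1 ^+ n) /\
    (intg (fun x => (Pf f (y n) x - Pf f (y m) x) ^+ 2) /\
     Int (fun x => (Pf f (y n) x - Pf f (y m) x) ^+ 2) <= 8^-1 ^+ n).
  move=> nm; have [h1 h2 h3] := hy n m nm.
  have [i1 i2 E] := QP_diff bf (y0 n) (y0 m).
  have g1 : 0 <= Int (fun x => (Qf f (y n) x - Qf f (y m) x) ^+ 2).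
    by apply: Int_ge0 => x; exact: sqr_ge0.
  have g2 : 0 <= Int (fun x => (Pf f (y n) x - Pf f (y m) x) ^+ 2).
    by apply: Int_ge0 => x; exact: sqr_ge0.
  have : 2 * pi * (Int (fun x => f x * Pf f (y n + y n) x) + Int (fun x => f x * Pf f (y m + y m) x)
     - 2 * Int (fun x => f x * Pf f (y n + y m) x)) <= 8^-1 ^+ n.
    rewrite [leRHS](scale_splitE _ pn) -/(a n).
    rewrite ler_pM2l ?mulr_gt0//.
    exact: second_diff_le h1 h2 h3.
  rewrite -E => E'; split; split.
  - exact: i1.
  - by apply: le_trans E'; rewrite lerDl; exact: g2.
  - exact: i2.
  by apply: le_trans E'; rewrite lerDr; exact: g1.
have [g [mg ug hg]] := L2_complete mQ (fun n m nm => (QP n m nm).1).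
have uP : {ae mu, forall t, Pf f (y n) t @[n --> \oo] --> pi * f t}.
  apply: (aeS (bsupp_leb bf)) => t lt; apply/cvgrPdist_le => e e0.
  have [d d0 hd] := Pf_leb bf lt e0.
  move/cvgr0_norm_lt : yl => /(_ _ d0); apply: filterS => n yn.
  by rewrite distrC; apply: hd; rewrite y0 -[ltLHS]gtr0_norm.
have mpf : meas (fun t => pi * f t) by apply: measurable_funM => //; exact: bf.1.
have hP n : intg (fun x => (Pf f (y n) x - pi * f x) ^+ 2) /\
    Int (fun x => (Pf f (y n) x - pi * f x) ^+ 2) <= 8^-1 ^+ n.
  apply: (@L2_fatou R (fun m => Pf f (y (n + m)%N))) => //.
  - by apply: (aeS uP) => t; move/(cvg_comp _ _ (cvg_addnl n)); exact.
  - by move=> m; have [_] := QP n (n + m)%N (leq_addr _ _).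
have ig : intg (fun t => g t ^+ 2).
  apply: (@intg_le _ _ (fun t => 2 * (Qf f (y 0%N) t * Qf f (y 0%N) t) + 2 * (Qf f (y 0%N) t - g t) ^+ 2)).
  - exact: measurable_funX.
  - by apply: intgD; apply: intgZ; [exact: (intg_mul_sqdom (sQ 0%N) (sQ 0%N))|exact: (hg 0%N).1].
  move=> x; rewrite ger0_norm ?sqr_ge0//.
  exact: sqr_le2.
(* Letting the other height tend to 0 in [QP_semigroup], Q tends to [g] and P to [pi * f] in L^2.
   The second term becomes [pi * Qf f s t] and is subtracted from the limit 2 pi [Qf f s t]. *)
have semi s t : 0 < s -> intg (fun x => g x * pk s (x - t)) /\
    Int (fun x => g x * pk s (x - t)) = pi * Qf f s t.
  move=> s0.
  have Sp := sqdom_shift t (sqdom_pk s0); have Sq := sqdom_shift t (sqdom_qk s0).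
  have Sp' : sqdom ((1 + s ^- 2) * (2 * (1 + t ^+ 2))) (fun x => pk s (x - t)).
    by have -> : (fun x => pk s (x - t)) = (fun x => pk s (t - x)) by apply/funext => x; exact: pkB.
  have Sq' : sqdom ((1 + s ^- 2) * (2 * (1 + t ^+ 2))) (fun x => qk s (x - t)).
    split; last by move=> u; rewrite qkB sqrrN; exact: Sq.2.
    by apply: (measurableT_comp (meas_qk s)); exact: measurable_funB.
  have sq2 C k : sqdom C k -> intg (fun x => k x ^+ 2).
    by move=> Sk; apply: (eq_intg _ (intg_mul_sqdom Sk Sk)) => x; rewrite expr2.
  have [i1 c1] := L2_weak mQ mg Sp'.1 (sq2 _ _ Sp') (fun n => intg_mul_sqdom (sQ n) Sp') hg.
  have [i2 c2] := L2_weak mP mpf Sq'.1 (sq2 _ _ Sq') (fun n => intg_mul_sqdom (sP n) Sq') hP.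
  split=> //.
  have c3 : 2 * pi * Qf f (s + y n) t @[n --> \oo] --> 2 * pi * Qf f s t.
    by apply: cvgM; [exact: cvg_cst|exact: Qf_cvg bf s0 y0 yl].
  have c5 : 2 * pi * Qf f (s + y n) t @[n --> \oo] -->
      Int (fun x => g x * pk s (x - t)) + Int (fun x => pi * f x * qk s (x - t)).
    have -> : (fun n => 2 * pi * Qf f (s + y n) t) = (fun n =>
        Int (fun x => Qf f (y n) x * pk s (x - t)) + Int (fun x => Pf f (y n) x * qk s (x - t))).
      by apply/funext => n; rewrite -(QP_semigroup t bf s0 (y0 n)).
    exact: (cvgD c1 c2).
  have E := cvg_unique (@Rhausdorff R) c3 c5.
  have E2 : Int (fun x => pi * f x * qk s (x - t)) = pi * Qf f s t.
    rewrite /Qf /conv -IntZ; last exact: (sqdom_conv bf (sqdom_qk s0)).1.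
    by apply: eq_Int => x; rewrite mulrA.
  rewrite E2 in E; apply: (addIr (pi * Qf f s t)); by rewrite -E -mulrA mulr_natl mulr2n.
exists g; split=> //.
- apply: (aeS (aeI (bsupp_leb bf) (ae_leb_pt_L2 mg ig))) => t [lf lg].
  by apply: (leb_pt_tk_cvg bf mg lf lg) => s s0; exact: semi.
move=> b b0 hb; rewrite -/F; set G := Int _.
have G0 : 0 <= G by apply: Int_ge0 => x; rewrite mulr_ge0 ?sqr_ge0 ?indicI_ge0.
have F0 : 0 <= F by apply: Int_ge0 => x; exact: sqr_ge0.
have iF : intg (fun x => f x ^+ 2) := bsupp_intg (bsupp_sqr bf).
have iG : intg (fun t => g t ^+ 2 * \1_I t).
  apply: (intg_le _ ig).
    apply: measurable_funM; first exact: measurable_funX.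
    by apply: measurable_indic; exact: measurable_itv.
  move=> x; rewrite ger0_norm; last by rewrite mulr_ge0 ?sqr_ge0 ?indicI_ge0.
  by rewrite ler_piMr ?sqr_ge0// indicE; case: (_ \in _).
have split_bound h n x : 0 < h -> Qf f (y n) x ^+ 2 <= ((1 + h) * (g x ^+ 2 * \1_I x) +
    (1 + h^-1) * (Qf f (y n) x - g x) ^+ 2) + b * pk 1 x.
  by move=> h0; apply: (sqr_le_split_out _ h0 b0 (pk_ge0 x (@ltr01 R))); exact: (hb _ _ (y0 n)).
(* The energy identity at height [y n]: its right side is nearly 2 pi^2 F, P contributes about pi^2
   F, and the rest has to come from Q. Letting n grow and then h shrink leaves the claim. *)
have key h n : 0 < h ->
    2 * pi ^+ 2 * F <= (1 + h) * (G + pi ^+ 2 * F) + b * pi + (3 + 2 * h^-1) * 8^-1 ^+ n.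
  move=> h0; have h1 : 0 < 1 + h^-1 by rewrite addr_gt0 ?invr_gt0.
  have [e1 _ _] := hy n n (leqnn n).
  have E := QP_energy bf (y0 n) (y0 n).
  have iQQ := intg_mul_sqdom (sQ n) (sQ n); have iPP := intg_mul_sqdom (sP n) (sP n).
  rewrite (IntD iQQ iPP) in E.
  have [j1 l1] := hg n; have [j2 l2] := hP n; have [j3 J3] := intg_pk1_pi R.
  have LP : Int (fun t => Pf f (y n) t * Pf f (y n) t) <=
      (1 + h) * (pi ^+ 2 * F) + (1 + h^-1) * 8^-1 ^+ n.
    apply: (@le_trans _ _ (Int (fun t => (1 + h) * (pi ^+ 2 * f t ^+ 2) +
        (1 + h^-1) * (Pf f (y n) t - pi * f t) ^+ 2))).
      apply: Int_le; [exact: iPP|exact: (intgD (intgZ _ (intgZ _ iF)) (intgZ _ j2))|move=> x].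
      by rewrite -expr2 -exprMn; exact: sqr_le_split.
    rewrite (IntD (intgZ _ (intgZ _ iF)) (intgZ _ j2)) (IntZ _ (intgZ _ iF)) (IntZ _ iF) (IntZ _ j2).
    by rewrite lerD2l (ler_pM2l h1); exact: l2.
  have LQ : Int (fun t => Qf f (y n) t * Qf f (y n) t) <=
      (1 + h) * G + (1 + h^-1) * 8^-1 ^+ n + b * pi.
    apply: (@le_trans _ _ (Int (fun t => ((1 + h) * (g t ^+ 2 * \1_I t) +
        (1 + h^-1) * (Qf f (y n) t - g t) ^+ 2) + b * pk 1 t))).
      apply: Int_le; [exact: iQQ| |by move=> x; rewrite -expr2; exact: (split_bound h n x h0)].
      exact: (intgD (intgD (intgZ _ iG) (intgZ _ j1)) (intgZ _ j3)).
    rewrite (IntD (intgD (intgZ _ iG) (intgZ _ j1)) (intgZ _ j3)).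
    rewrite (IntD (intgZ _ iG) (intgZ _ j1)) (IntZ _ iG) (IntZ _ j1) (IntZ _ j3) J3.
    by rewrite lerD2r lerD2l (ler_pM2l h1); exact: l1.
  move: e1; rewrite ler_norml => /andP[e1 _].
  rewrite lerBrDr addrC in e1.
  have e2 := le_pi (pi * F - a n) _ e1.
  have e3 : 2 * pi * a n <= 8^-1 ^+ n by exact: (scale_split_le (p8 n) pn).
  rewrite -E in e2; have -> : 2 * pi ^+ 2 * F = 2 * pi * (pi * F - a n) + 2 * pi * a n by ring.
  apply: energy_sum_le; exact: (lerD (le_trans e2 (lerD LQ LP)) e3).
apply/ler_addgt0Pr => e e0; set X := G + pi ^+ 2 * F.
have X0 : 0 <= X by rewrite addr_ge0// mulr_ge0// sqr_ge0.
(* This makes [h * X] at most e/2; the 1 covers the case X = 0. *)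
pose h := e / (2 * (X + 1)).
have h0 : 0 < h by rewrite divr_gt0// mulr_gt0// ltr_wpDl.
have hX : h * X <= e / 2.
  rewrite /h mulrAC ler_pdivrMr ?mulr_gt0 ?ltr_wpDl//.
  have -> : e / 2 * (2 * (X + 1)) = e * X + e by field.
  by rewrite lerDl ltW.
have : (3 + 2 * h^-1) * 8^-1 ^+ n @[n --> \oo] --> 0.
  rewrite -(mulr0 (3 + 2 * h^-1)); apply: cvgM; first exact: cvg_cst.
  by apply: cvg_expr; rewrite gtr0_norm ?invr_gt0// invf_lt1// ltr1n.
move/cvgr0_norm_le => /(_ (e / 2) (divr_gt0 e0 (ltr0n _ 2))) [N _ hN].
have := hN N (leqnn N) => /=; move/(le_trans (ler_norm _)) => hN'.
have := key h N h0; rewrite -/X; have -> : (1 + h) * X = X + h * X by ring.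
move=> kk; apply: (energy_limit_le (erefl X) hX); apply: (le_trans kk); by rewrite lerD2l.
Qed.

End Hilbert.

(** * Signs on disjoint pieces *)

Section Signs.
Variable R : realType.
Notation mu := (@lebesgue_measure R).
Implicit Types f g h : R -> R.
Let I := @I11 R.

(** A relation on the whole line, without the factor 1/pi, which returns in [hilbertRE]. Being a
    statement about limits, it is visibly linear. *)
Definition is_hilbert f g := [/\ meas g, intg (fun t => g t ^+ 2) &
  {ae mu, forall t, Int (fun x => f x * tk s (x - t)) @[s --> 0^'+] --> g t}].

Definition sqnormI g : R := Int (fun t => g t ^+ 2 * \1_I t).

Lemma tk_bound (s u : R) : 0 < s -> `|tk s u| <= s^-1.
Proof.
move=> s0; rewrite /tk; case: ifPn => [_|]; first by rewrite normr0 invr_ge0 ltW.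
by rewrite -ltNge => su; rewrite normfV lef_pV2 ?posrE ?(ltW su)// (lt_trans s0).
Qed.

Lemma intg_tk M f s t : bsupp M f -> 0 < s -> intg (fun x => f x * tk s (x - t)).
Proof.
move=> bf s0; have M0 := bsupp_ge0 bf.
apply: (@intg_le _ _ (fun x => s^-1 * `|f x|)).
- apply: measurable_funM; first exact: bf.1.
  by apply: (measurableT_comp (meas_tk s)); exact: measurable_funB.
- by apply: intgZ; apply: intg_abs; exact: bsupp_intg bf.
by move=> x; rewrite (normrM (f x)) mulrC ler_wpM2r// tk_bound.
Qed.

Lemma sqr_comb_le (a b s : R) : (a + s * b) ^+ 2 <= 2 * a ^+ 2 + 2 * s ^+ 2 * b ^+ 2.
Proof. have := sqr_ge0 (a - s * b); nra. Qed.

Lemma intg_sqr_comb g h s : meas g -> meas h -> intg (fun t => g t ^+ 2) ->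
  intg (fun t => h t ^+ 2) -> meas (fun t => g t + s * h t) /\
  intg (fun t => (g t + s * h t) ^+ 2).
Proof.
move=> mg mh ig ih.
have m : meas (fun t => g t + s * h t).
  by apply: measurable_funD => //; apply: measurable_funM.
split=> //; apply: (@intg_le _ _ (fun t => 2 * g t ^+ 2 + 2 * s ^+ 2 * h t ^+ 2)).
- exact: measurable_funX.
- by apply: intgD; exact: intgZ.
by move=> x; rewrite ger0_norm ?sqr_ge0// sqr_comb_le.
Qed.

Lemma is_hilbert_comb M f1 f2 g1 g2 s : bsupp M f1 -> bsupp M f2 -> is_hilbert f1 g1 -> is_hilbert f2 g2 ->
  is_hilbert (fun x => f1 x + s * f2 x) (fun x => g1 x + s * g2 x).
Proof.
move=> b1 b2 [m1 i1 c1] [m2 i2 c2].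
have [m i] := intg_sqr_comb s m1 m2 i1 i2; split=> //.
apply: (aeS (aeI c1 c2)) => t [k1 k2].
have k : Int (fun x => f1 x * tk r (x - t)) + s * Int (fun x => f2 x * tk r (x - t))
    @[r --> 0^'+] --> g1 t + s * g2 t.
  by apply: cvgD => //; apply: cvgM => //; exact: cvg_cst.
apply: cvg_trans k; apply: near_eq_cvg; near=> r.
have r0 : 0 < r by near: r; exact: nbhs_right_gt.
rewrite -(IntZ _ (intg_tk t b2 r0)) -(IntD (intg_tk t b1 r0) (intgZ _ (intg_tk t b2 r0))).
by apply: eq_Int => x; rewrite mulrDl mulrA.
Unshelve. all: by end_near.
Qed.

Lemma intg_sqrI g : meas g -> intg (fun t => g t ^+ 2) -> intg (fun t => g t ^+ 2 * \1_I t).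
Proof.
move=> mg ig; apply: (intg_le _ ig).
  apply: measurable_funM; first exact: measurable_funX.
  by apply: measurable_indic; exact: measurable_itv.
move=> x; rewrite ger0_norm; last by rewrite mulr_ge0 ?sqr_ge0 ?indicI_ge0.
by rewrite ler_piMr ?sqr_ge0// indicE; case: (_ \in _).
Qed.

Lemma parallelogram g h : meas g -> meas h -> intg (fun t => g t ^+ 2) ->
  intg (fun t => h t ^+ 2) ->
  sqnormI (fun t => g t + 1 * h t) + sqnormI (fun t => g t + -1 * h t) = 2 * sqnormI g + 2 * sqnormI h.
Proof.
move=> mg mh ig ih; rewrite /sqnormI.
have [m1 i1] := intg_sqr_comb 1 mg mh ig ih.
have [m2 i2] := intg_sqr_comb (-1) mg mh ig ih.
have j := intg_sqrI mg ig; have k := intg_sqrI mh ih.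
rewrite -(IntD (intg_sqrI m1 i1) (intg_sqrI m2 i2)) -(IntZ _ j) -(IntZ _ k).
rewrite -(IntD (intgZ _ j) (intgZ _ k)).
by apply: eq_Int => x; ring.
Qed.

Lemma sign_choice_real (a b c d e f g h : R) : a + b = 2 * c + 2 * d -> e + f = 2 * g + 2 * h ->
  c + g + (d + h) <= a + e \/ c + g + (d + h) <= b + f.
Proof. by move=> ab ef; case: (leP (c + g + (d + h)) (a + e)) => k; [left|right]; lra. Qed.

(** By the parallelogram law the mean over s = 1 and s = -1 of the total energy of both components
    equals the left-hand side, so one of the two signs reaches it for the components jointly. *)
Lemma sign_choice f1 f2 f1' f2' g1 g2 h1 h2 : is_hilbert f1 g1 -> is_hilbert f2 g2 -> is_hilbert f1' h1 -> is_hilbert f2' h2 ->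
  exists2 s, s ^+ 2 = 1 & sqnormI g1 + sqnormI g2 + (sqnormI h1 + sqnormI h2) <=
    sqnormI (fun t => g1 t + s * h1 t) + sqnormI (fun t => g2 t + s * h2 t).
Proof.
move=> [m1 i1 _] [m2 i2 _] [m3 i3 _] [m4 i4 _].
have [h|h] := sign_choice_real (parallelogram m1 m3 i1 i3) (parallelogram m2 m4 i2 i4).
  by exists 1; rewrite ?expr1n.
by exists (-1); rewrite ?sqrrN ?expr1n.
Qed.

Lemma bsupp_mul M f k : bsupp M f -> meas k -> (forall x, k x ^+ 2 <= 1) ->
  bsupp M (fun x => f x * k x).
Proof.
move=> bf mk k1; split; first by apply: measurable_funM => //; exact: bf.1.
move=> x; rewrite normrM; apply: le_trans (bf.2 x); rewrite ler_piMr//.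
by rewrite -(@expr_le1 _ 2)// real_normK ?num_real// k1.
Qed.

(** A sign on part of the line, zero elsewhere, is encoded by [th ^+ 2 = k0]; in use, [k0] and [k]
    are indicators. Disjointness makes the cross term in the square of the new sign vanish. *)
Lemma add_piece M f1 f2 th k0 k g1 g2 h1 h2 : bsupp M f1 -> bsupp M f2 ->
  meas th -> (forall x, th x ^+ 2 = k0 x) -> meas k -> (forall x, k x ^+ 2 = k x) ->
  (forall x, k0 x * k x = 0) -> (forall x, k0 x + k x <= 1) ->
  is_hilbert (fun x => f1 x * th x) g1 -> is_hilbert (fun x => f2 x * th x) g2 ->
  is_hilbert (fun x => f1 x * k x) h1 -> is_hilbert (fun x => f2 x * k x) h2 ->
  exists th' g1' g2', [/\ meas th' /\ (forall x, th' x ^+ 2 = k0 x + k x),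
    is_hilbert (fun x => f1 x * th' x) g1', is_hilbert (fun x => f2 x * th' x) g2' &
    sqnormI g1 + sqnormI g2 + (sqnormI h1 + sqnormI h2) <= sqnormI g1' + sqnormI g2'].
Proof.
move=> b1 b2 mth thk mk kk k0k le1 H1 H2 K1 K2.
have [s s1 sle] := sign_choice H1 H2 K1 K2.
have th1 x : th x ^+ 2 <= 1.
  by rewrite thk; apply: le_trans (le1 x); rewrite lerDl -kk sqr_ge0.
have k1 x : k x ^+ 2 <= 1.
  by rewrite kk; apply: le_trans (le1 x); rewrite lerDr -thk sqr_ge0.
exists (fun x => th x + s * k x), (fun x => g1 x + s * h1 x), (fun x => g2 x + s * h2 x).
split=> //.
- split=> [|x]; first by apply: measurable_funD => //; exact: measurable_funM.
  have z : th x * k x = 0.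
    by apply/eqP; rewrite -sqrf_eq0 exprMn thk kk k0k.
  rewrite sqrrD exprMn s1 mul1r thk kk mulrCA z mulr0 mul0rn addr0//.
- have -> : (fun x => f1 x * (th x + s * k x)) = (fun x => f1 x * th x + s * (f1 x * k x)).
    by apply/funext => x; rewrite mulrDr mulrCA.
  by apply: is_hilbert_comb => //; [exact: bsupp_mul b1 mth th1|exact: bsupp_mul b1 mk k1].
have -> : (fun x => f2 x * (th x + s * k x)) = (fun x => f2 x * th x + s * (f2 x * k x)).
  by apply/funext => x; rewrite mulrDr mulrCA.
by apply: is_hilbert_comb => //; [exact: bsupp_mul b2 mth th1|exact: bsupp_mul b2 mk k1].
Qed.

(** * Decay off (-1, 1) for short pieces, and summation over them *)

Lemma intg_itv (a c : R) : intg (\1_(`[a, c[ : set R)).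
Proof. exact: (@integrable_indic_itv R a c true true). Qed.

Lemma Int_itv (a c : R) : a <= c -> Int (\1_(`[a, c[ : set R)) = c - a.
Proof.
move=> ac; rewrite /Int /Rintegral integral_indic//= setIT.
rewrite lebesgue_measure_itv/= lte_fin; case: ltP => //= ca.
by apply/esym/eqP; rewrite subr_eq0 eq_le ca ac.
Qed.

Lemma qk_le_inv (y u r : R) : 0 < r -> r <= `|u| -> `|qk y u| <= r^-1.
Proof.
move=> r0 ru; have u0 : 0 < `|u| := lt_le_trans r0 ru.
have un : u != 0 by rewrite -normr_gt0.
have d0 : 0 < u ^+ 2 + y ^+ 2 by rewrite ltr_pwDl ?sqr_ge0// exprn_even_gt0.
apply: (@le_trans _ _ `|u|^-1); last by rewrite lef_pV2 ?posrE.
rewrite /qk normrM normfV (gtr0_norm d0) ler_pdivrMr// mulrC.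
by rewrite ler_pdivlMr// -expr2 real_normK ?num_real// lerDl sqr_ge0.
Qed.

Lemma out_ge1 (t : R) : ~ I t -> 1 <= `|t|.
Proof.
move=> nI; rewrite leNgt; apply/negP; rewrite ltr_norml => h; apply: nI.
by rewrite /I /I11 /= in_itv.
Qed.

(** |x - t| >= |t| - 1 + d, which exceeds d |t| by (1 - d) (|t| - 1) >= 0. *)
Lemma dist_out (x t d : R) : 0 < d -> 1 <= `|t| -> `|x| <= 1 - d -> d * `|t| <= `|x - t|.
Proof.
move=> d0 t1 xd; have := ler_normD (t - x) x; rewrite subrK distrC.
have d1 : 0 <= 1 - d := le_trans (normr_ge0 x) xd.
have : 0 <= (1 - d) * (`|t| - 1) by rewrite mulr_ge0// subr_ge0.
move: (`|t|) (`|x|) (`|x - t|) t1 xd => T X Z ? ? ? ?; lra.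
Qed.

Lemma pk1_out (t : R) : 1 <= `|t| -> `|t| ^- 2 <= 2 * pk 1 t.
Proof.
move=> t1; have t2 : 1 <= t ^+ 2 by rewrite -(real_normK (num_real t)) exprn_ege1.
rewrite /pk expr1n mul1r real_normK ?num_real//.
rewrite -[leLHS]mul1r ler_pdivrMr; last by apply: lt_le_trans t2.
rewrite mulrAC ler_pdivlMr; last by lra.
lra.
Qed.

(** The bound is uniform in [y], as [hilbert_L2] demands, and quadratic in [l]. The factor 2 comes
    from t^-2 <= 2 / (1 + t^2) for |t| >= 1. *)
Lemma piece_bound M f (a l d y t : R) : bsupp M f ->
  (forall x, ~ (`[a, a + l[%classic : set R) x -> f x = 0) -> 0 < d -> 0 <= l ->
  d - 1 <= a -> a + l <= 1 - d -> ~ I t ->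
  0 < y -> Qf f y t ^+ 2 <= (2 * (M * l / d) ^+ 2) * pk 1 t.
Proof.
move=> bf f0 d0 l0 al au nI y0; have M0 := bsupp_ge0 bf.
have t1 := out_ge1 nI; have t0 : 0 < `|t| by apply: lt_le_trans t1.
have iq := (sqdom_conv bf (sqdom_qk y0)).1 t.
have h : `|Qf f y t| <= M * l / d / `|t|.
  apply: (le_trans (Int_abs iq)).
  apply: (@le_trans _ _ (Int (fun x => M * (d * `|t|)^-1 * \1_(`[a, a + l[ : set R) x))).
    apply: Int_le; [exact: intg_abs|apply: intgZ; exact: intg_itv|move=> x].
    rewrite (normrM (f x)); have [xa|xa] := pselect ((`[a, a + l[%classic : set R) x); last first.
      by rewrite f0// normr0 mul0r indicE memNset// mulr0.
    rewrite indicE mem_set// mulr1; apply: ler_pM => //; first exact: bsupp_bnd bf.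
    apply: qk_le_inv; first by rewrite mulr_gt0.
    apply: dist_out => //; move: xa; rewrite /= in_itv/= => /andP[? ?].
    by rewrite ler_norml; apply/andP; split; lra.
  rewrite IntZ; last exact: intg_itv.
  rewrite Int_itv ?lerDl//; have -> : a + l - a = l by ring.
  by rewrite invfM; lra.
have [B0 B1] : 0 <= M * l / d / `|t| /\ 0 <= (M * l / d) ^+ 2.
  by rewrite sqr_ge0 divr_ge0 ?divr_ge0 ?mulr_ge0// ltW.
rewrite -(real_normK (num_real (Qf f y t))).
apply: (@le_trans _ _ ((M * l / d / `|t|) ^+ 2)); first by rewrite lerXn2r ?nnegrE.
rewrite exprMn exprVn [leRHS]mulrAC [leRHS]mulrC; apply: ler_wpM2l => //.
exact: pk1_out.
Qed.

Lemma indic_itvE (a c x : R) : \1_(`[a, c[%classic : set R) x = ((a <= x < c)%R)%:R :> R.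
Proof. by rewrite indicE mem_setE in_itv. Qed.

Lemma indic_itv_split (a b c x : R) : a <= b -> b <= c -> \1_(`[a, c[%classic : set R) x =
  \1_(`[a, b[%classic : set R) x + \1_(`[b, c[%classic : set R) x :> R.
Proof.
move=> ab bc; rewrite !indic_itvE; case: (ltP x b) => xb.
  by rewrite (lt_le_trans xb bc) /= addr0.
by rewrite (le_trans ab xb) /= add0r.
Qed.

Lemma indic_itv_disj (a b c x : R) :
  \1_(`[a, b[%classic : set R) x * \1_(`[b, c[%classic : set R) x = 0 :> R.
Proof.
rewrite !indic_itvE; case: (ltP x b) => xb; last by rewrite andbF mul0r.
by rewrite /= mulr0.
Qed.

Lemma indic_sqr (A : set R) x : (\1_A x : R) ^+ 2 = \1_A x.
Proof. by rewrite indicE; case: (_ \in _); rewrite ?expr1n ?expr0n. Qed.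

Lemma meas_indic_itv (a c : R) : meas (\1_(`[a, c[%classic : set R) : R -> R).
Proof. by apply: measurable_indic; exact: measurable_itv. Qed.

Lemma bsupp_add_sqr M f1 f2 : bsupp M f1 -> bsupp M f2 ->
  bsupp (2 * M ^+ 2) (fun x => f1 x ^+ 2 + f2 x ^+ 2).
Proof.
move=> /bsupp_sqr [m1 h1] /bsupp_sqr [m2 h2]; split; first exact: measurable_funD.
move=> x; apply: (le_trans (ler_normD _ _)).
by apply: (le_trans (lerD (h1 x) (h2 x))); rewrite le_eqVlt -mulrA mulr_natl mulr2n eqxx.
Qed.

Lemma is_hilbert0 f : is_hilbert (fun x => f x * 0) (fun=> 0).
Proof.
split; [exact: measurable_cst|by apply: (eq_intg _ (@intg0 R)) => x; rewrite expr0n|].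
exists set0; split=> // t; apply: contra_notP => _.
rewrite /= (_ : (fun s => Int _) = fun=> 0); first exact: cvg_cst.
apply/funext => s; rewrite -[RHS](mul0r (Int (fun=> 0))) -(IntZ _ (@intg0 R)).
by apply: eq_Int => x; rewrite mulr0 !mul0r.
Qed.

Lemma pieces_step (P X Y A B C : R) (n : nat) b p G H G' : P * X <= G + n%:R * (2 * (b * p)) ->
  P * A <= B + b * p -> P * Y <= C + b * p -> G + (B + C) <= G' -> H = X + (A + Y) ->
  P * H <= G' + n.+1%:R * (2 * (b * p)).
Proof. by move=> h1 h2 h3 h4 ->; rewrite -natr1; move: (n%:R) h1 => N h1; lra. Qed.

(** Induction on the number of intervals: half-open ones of equal length adjoin exactly. Each adds
    the loss [b * pi] of [hilbert_L2] with b = 2 (M l / d)^2, once for each of the two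
    components. *)
Lemma pieces M f1 f2 (a d l : R) n : bsupp M f1 -> bsupp M f2 -> 0 < d -> 0 <= l ->
  d - 1 <= a -> a + n%:R * l <= 1 - d ->
  let k := \1_(`[a, a + n%:R * l[%classic : set R) : R -> R in
  exists th g1 g2, [/\ meas th /\ (forall x, th x ^+ 2 = k x),
    is_hilbert (fun x => f1 x * th x) g1, is_hilbert (fun x => f2 x * th x) g2 &
    pi ^+ 2 * Int (fun x => (f1 x ^+ 2 + f2 x ^+ 2) * k x) <=
      sqnormI g1 + sqnormI g2 + n%:R * (2 * (2 * (M * l / d) ^+ 2 * pi))].
Proof.
move=> b1 b2 d0 l0 al; elim: n => [|n IHn] au /=.
  have z x : \1_(`[a, a + 0%:R * l[%classic : set R) x = 0 :> R.
    by rewrite indic_itvE mul0r addr0; case: (leP a x).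
  exists (fun=> 0), (fun=> 0), (fun=> 0); split; try exact: is_hilbert0.
    by split=> [|x]; [exact: measurable_cst|rewrite expr0n z].
  rewrite (@eq_Int _ _ (fun=> 0 * 0)); last by move=> x; rewrite z mulr0 mul0r.
  rewrite IntZ; last exact: intg0.
  by rewrite !mul0r mulr0 addr0 addr_ge0// Int_ge0// => x; rewrite mulr_ge0 ?sqr_ge0 ?indicI_ge0.
have nl : a + n.+1%:R * l = a + n%:R * l + l by rewrite -natr1; ring.
have [|th [g1 [g2 [[mth thk] H1 H2 E]]]] := IHn.
  by apply: le_trans au; rewrite nl lerDl.
set c := a + n%:R * l in thk E.
have ac : a <= c by rewrite lerDl mulr_ge0.
have cl : c <= c + l by rewrite lerDl.
pose k : R -> R := \1_(`[c, c + l[%classic : set R).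
have mk : meas k := meas_indic_itv c (c + l).
have kk x : k x ^+ 2 = k x := indic_sqr _ x.
have k1 x : k x ^+ 2 <= 1 by rewrite kk /k indic_itvE; case: (_ && _).
have bk f : bsupp M f -> bsupp M (fun x => f x * k x) by move=> bf; exact: bsupp_mul bf mk k1.
have piece f : bsupp M f -> exists2 h, is_hilbert (fun x => f x * k x) h &
    pi ^+ 2 * Int (fun x => (f x * k x) ^+ 2) <= sqnormI h + 2 * (M * l / d) ^+ 2 * pi.
  move=> bf; have [h [mh ih ch Eh]] := hilbert_L2 (bk f bf); exists h => //.
  apply: Eh; first by rewrite mulr_ge0// sqr_ge0.
  move=> y t y0 nI; apply: (@piece_bound M _ c) => //.
  - exact: bk.
  - by move=> x xc; rewrite /k indicE memNset// mulr0.
  - by apply: le_trans ac.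
  - by rewrite -nl.
have [h1 K1 E1] := piece f1 b1; have [h2 K2 E2] := piece f2 b2.
have [||th' [g1' [g2' [[mth' thk'] H1' H2' E']]]] := add_piece b1 b2 mth thk mk kk _ _ H1 H2 K1 K2.
- by move=> x; exact: indic_itv_disj.
- by move=> x; rewrite -indic_itv_split// indic_itvE; case: (_ && _).
exists th', g1', g2'; split=> //.
  by split=> // x; rewrite thk' nl -/c (indic_itv_split _ ac cl).
apply: (pieces_step E E1 E2 E'); rewrite nl -/c.
have ii f : bsupp M f -> intg (fun x => (f x * k x) ^+ 2).
  by move=> bf; apply: bsupp_intg (bsupp_sqr (bk f bf)).
have i0 : intg (fun x => (f1 x ^+ 2 + f2 x ^+ 2) * \1_(`[a, c[%classic : set R) x).
  apply: bsupp_intg; apply: bsupp_mul (bsupp_add_sqr b1 b2) (meas_indic_itv a c) _.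
  by move=> x; rewrite indic_sqr indic_itvE; case: (_ && _).
rewrite -(IntD (ii f1 b1) (ii f2 b2)) -(IntD i0 (intgD (ii f1 b1) (ii f2 b2))).
by apply: eq_Int => x; rewrite (indic_itv_split _ ac cl) !exprMn kk -/(k x); ring.
Qed.

(** With pieces of length (2 - 2d) / N the total loss is 16 p M^2 (1 - d)^2 / (d^2 N). *)
Lemma piece_err (N M d p e : R) : 0 < N -> 0 < d -> d <= 1 -> 0 <= p ->
  16 * p * M ^+ 2 / d ^+ 2 <= e / 2 * N ->
  N * (2 * (2 * (M * ((2 - 2 * d) / N) / d) ^+ 2 * p)) <= e / 2.
Proof.
move=> N0 d0 d1 p0 h; have Nn : N != 0 by rewrite gt_eqF.
have dn : d != 0 by rewrite gt_eqF.
have -> : N * (2 * (2 * (M * ((2 - 2 * d) / N) / d) ^+ 2 * p)) =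
  16 * p * M ^+ 2 / d ^+ 2 * (1 - d) ^+ 2 / N by field; rewrite Nn dn.
rewrite ler_pdivrMr//; apply: le_trans h; rewrite ler_piMr//.
  by apply: divr_ge0; [apply: mulr_ge0; [exact: mulr_ge0|exact: sqr_ge0]|exact: sqr_ge0].
by rewrite expr_le1// ?subr_ge0// lerBlDr lerDl (ltW d0).
Qed.

Lemma combine_err (P F K c1 d e G H G' E : R) : 0 <= P -> F <= K + c1 * d -> P * K <= G + E ->
  0 <= H -> G + H <= G' -> P * c1 * d <= e / 2 -> E <= e / 2 -> P * F <= G' + e.
Proof.
move=> P0 FK PK H0 GG h1 h2; have := ler_wpM2l P0 FK; rewrite mulrDr mulrA; lra.
Qed.

(** Half of [e] pays for the strips near the endpoints, through [d]; the other half pays for the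
    pieces, through [N], chosen once [d] is fixed. *)
Lemma unimodular_lower M f1 f2 (e : R) : bsupp M f1 -> bsupp M f2 -> 0 < e ->
  exists th g1 g2, [/\ meas th /\ (forall x, th x ^+ 2 = 1),
    is_hilbert (fun x => f1 x * th x) g1, is_hilbert (fun x => f2 x * th x) g2 &
    pi ^+ 2 * Int (fun x => f1 x ^+ 2 + f2 x ^+ 2) <= sqnormI g1 + sqnormI g2 + e].
Proof.
move=> b1 b2 e0; have M0 := bsupp_ge0 b1; have pi0 : 0 < pi :> R := pi_gt0 R.
pose C : R := pi ^+ 2 * (4 * M ^+ 2).
have C0 : 0 <= C by apply: mulr_ge0; [exact: sqr_ge0|apply: mulr_ge0; [|exact: sqr_ge0]].
have Ce : 0 < C + e by rewrite ltr_wpDl.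
(* Gives [C * d <= e / 2] and [d <= 1] also when C = 0. *)
pose d := e / (2 * (C + e)).
have d0 : 0 < d by rewrite divr_gt0 ?mulr_gt0.
have d1 : d <= 1.
  rewrite ler_pdivrMr ?mulr_gt0// mul1r mulr_natl mulr2n -[leLHS]add0r.
  by rewrite lerD ?(ltW Ce)// lerDr.
have Cd : C * d <= e / 2.
  rewrite /d mulrA ler_pdivrMr ?mulr_gt0//.
  have -> : e / 2 * (2 * (C + e)) = C * e + e * e by field.
  by rewrite lerDl mulr_ge0 ?(ltW e0).
pose D := 16 * pi * M ^+ 2 / d ^+ 2.
have D0 : 0 <= D.
  apply: divr_ge0; [apply: mulr_ge0; [|exact: sqr_ge0]|exact: sqr_ge0].
  by apply: mulr_ge0; rewrite ?(ltW pi0).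
pose N := (Num.bound (D / (e / 2))).+1.
have N0 : 0 < N%:R :> R by rewrite ltr0n.
have e2 : 0 < e / 2 by rewrite divr_gt0.
have DN : D <= e / 2 * N%:R.
  rewrite mulrC -ler_pdivrMr//; apply: (@le_trans _ _ (Num.bound (D / (e / 2)))%:R).
    by apply: ltW; apply: archi_boundP; rewrite divr_ge0 ?(ltW e2).
  by rewrite ler_nat.
pose l := (2 - 2 * d) / N%:R.
have l0 : 0 <= l by rewrite divr_ge0 ?(ltW N0)// subr_ge0 ler_piMr.
have Nl : d - 1 + N%:R * l = 1 - d.
  by rewrite /l mulrCA mulfV ?gt_eqF// mulr1; ring.
have [|th [g1 [g2 [[mth thk] H1 H2 E]]]] := @pieces M f1 f2 (d - 1) d l N b1 b2 d0 l0 (lexx _).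
  by rewrite Nl.
have Err : N%:R * (2 * (2 * (M * l / d) ^+ 2 * pi)) <= e / 2.
  by apply: piece_err => //; exact: (ltW pi0).
pose k0 : R -> R := \1_(`[d - 1, 1 - d[%classic : set R).
rewrite Nl in thk E.
have mk0 : meas k0 := meas_indic_itv _ _.
have k0k x : k0 x ^+ 2 = k0 x := indic_sqr _ x.
(* The whole complement of the central interval is one last piece, so that the sign has square 1
   everywhere. Its energy is only used to be nonnegative. *)
pose k x := 1 - k0 x.
have mk : meas k by apply: measurable_funB => //; exact: measurable_cst.
have kk x : k x ^+ 2 = k x by rewrite /k sqrrB k0k expr1n mul1r; ring.
have k1 x : k x ^+ 2 <= 1 by rewrite kk /k lerBlDr lerDl -k0k sqr_ge0.
have k01 x : k0 x ^+ 2 <= 1 by rewrite k0k /k0 indic_itvE; case: (_ && _).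
have [h1 [mh1 ih1 ch1 _]] := hilbert_L2 (bsupp_mul b1 mk k1).
have [h2 [mh2 ih2 ch2 _]] := hilbert_L2 (bsupp_mul b2 mk k1).
have [||th' [g1' [g2' [[mth' thk'] H1' H2' E']]]] := add_piece b1 b2 mth thk mk kk _ _ H1 H2
  (And3 mh1 ih1 ch1) (And3 mh2 ih2 ch2).
- by move=> x; rewrite /k mulrBr mulr1 -expr2 k0k subrr.
- by move=> x; rewrite /k addrC subrK.
exists th', g1', g2'; split=> //; first by split=> // x; rewrite thk' /k addrC subrK.
have hh0 : 0 <= sqnormI h1 + sqnormI h2.
  by rewrite addr_ge0// Int_ge0// => x; rewrite mulr_ge0 ?sqr_ge0 ?indicI_ge0.
apply: (combine_err (sqr_ge0 pi) _ E hh0 E' Cd Err).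
have bF := bsupp_add_sqr b1 b2; have iF := bsupp_intg bF.
have iK := bsupp_intg (bsupp_mul bF mk0 k01).
have i0 : intg (fun x => \1_I x - k0 x) by apply: intgB; [exact: intgI|exact: intg_itv].
(* The strips have total length 2d and [f1 ^+ 2 + f2 ^+ 2] is at most 2 M^2 there. *)
have -> : 4 * M ^+ 2 * d = 2 * M ^+ 2 * Int (fun x => \1_I x - k0 x).
  rewrite (IntB (@intgI R) (intg_itv _ _)) IntI Int_itv; last by move: d1; clear; lra.
  by ring.
rewrite -(IntZ _ i0) -(IntD iK (intgZ _ i0)).
apply: Int_le => //; first by apply: intgD => //; exact: intgZ.
move=> x; have := bF.2 x; move/(le_trans (ler_norm _)).
rewrite /k0 indic_itvE; have [/andP[x1 x2]|_] := boolP (d - 1 <= x < 1 - d); move=> Fx; rewrite ?mulr1 ?mulr0 ?subr0 ?add0r//.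
rewrite indicE mem_set ?subrr ?mulr0 ?addr0//.
rewrite /I /I11 /= in_itv /=; apply/andP; split.
  by apply: lt_le_trans x1; rewrite ltrBrDr addNr.
by apply: (lt_le_trans x2); rewrite lerBlDr lerDl (ltW d0).
Qed.

End Signs.

(** * Passage to the norms of the statement *)

Section Transfer.
Variable R : realType.
Notation mu := (@lebesgue_measure R).
Implicit Types f g h : R -> R.
Let I := @I11 R.

(** Compares the suprema over simple functions directly, because integrands built from [hilbert]
    come with no measurability. *)
Lemma ge0_le_integralT (f g : R -> \bar R) : (forall x, 0 <= f x)%E -> (forall x, f x <= g x)%E ->
  (\int[mu]_x f x <= \int[mu]_x g x)%E.
Proof.
move=> f0 fg; rewrite !ge0_integralTE//; last by move=> x; exact: le_trans (f0 x) (fg x).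
apply: ge_ereal_sup => _ [h hf <-]; apply: ereal_sup_ubound; exists h => // x.
exact: le_trans (hf x) (fg x).
Qed.

Lemma measI : measurable I. Proof. exact: measurable_itv. Qed.

(** Setting [G] to 0 on the null set does not change its integral and puts it below [h] everywhere;
    monotonicity then needs nothing more about [h]. *)
Lemma ae_le_integral (G h : R -> R) : meas G -> (forall t, 0 <= G t) -> (forall t, 0 <= h t) ->
  {ae mu, forall t, G t = h t} ->
  (\int[mu]_(t in I) (G t)%:E <= \int[mu]_(t in I) (h t)%:E)%E.
Proof.
move=> mG G0 h0 [N [mN N0 Nsub]].
have mG' : meas (fun t => G t * \1_(~` N) t).
  by apply: measurable_funM => //; apply: measurable_indic; exact: measurableC.
have G'0 t : 0 <= G t * \1_(~` N) t by rewrite mulr_ge0// indicE; case: (_ \in _).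
rewrite (@ge0_ae_eq_integral _ _ _ mu I _ (fun t => (G t * \1_(~` N) t)%:E)) //; last first.
- exists N; split=> // t; apply: contra_notP => nN _.
  by rewrite indicE mem_set// mulr1.
- by move=> t _; rewrite lee_fin.
- by move=> t _; rewrite lee_fin.
- by apply/measurable_funTS/measurable_EFinP.
- by apply/measurable_funTS/measurable_EFinP.
- exact: measI.
rewrite [leLHS]integral_mkcond [leRHS]integral_mkcond; apply: ge0_le_integralT => t.
  by rewrite patchE; case: ifP => // _; rewrite lee_fin.
rewrite !patchE; case: ifP => // _; rewrite lee_fin indicE.
have [tN|tN] := boolP (t \in ~` N); last by rewrite mulr0.
rewrite mulr1; have -> // : G t = h t.
by move: tN; rewrite inE => tN; apply: contrapT => E; apply: tN; exact: Nsub.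
Qed.

Lemma hilbert_truncE f t s :
  hilbert_trunc f t s = pi^-1 * Int (fun x => f x * \1_I x * tk s (x - t)).
Proof.
rewrite /hilbert_trunc Rintegral_mkcond; congr (_ * _); apply: eq_Int => x.
rewrite patchE /tk indicE.
have E : (x \in (`[t - s, t + s]%classic : set R)) = (`|x - t| <= s).
  rewrite mem_setE in_itv /= ler_norml.
  by congr (_ && _); apply/idP/idP; lra.
rewrite in_setD E; case: (x \in I); last by rewrite mulr0 mul0r.
by rewrite mulr1; case: (_ <= _); rewrite ?mulr0.
Qed.

(** Convergence almost everywhere gives [lim] its meaning; on the remaining null set its value is
    left open. *)
Lemma hilbertRE f g : is_hilbert (fun x => f x * \1_I x) g ->
  {ae mu, forall t, pi^-1 * g t = hilbertR f t}.
Proof.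
move=> [_ _ c]; apply: (aeS c) => t ct; apply/esym/cvg_lim; first exact: Rhausdorff.
have -> : hilbert_trunc f t = fun s => pi^-1 * Int (fun x => f x * \1_I x * tk s (x - t)).
  by apply/funext => s; exact: hilbert_truncE.
by apply: cvgM => //; exact: cvg_cst.
Qed.

Lemma L2norm_hilbert (F : cfun R) g1 g2 :
  is_hilbert (fun x => (F x).1 * \1_I x) g1 -> is_hilbert (fun x => (F x).2 * \1_I x) g2 ->
  ((pi ^- 2 * (sqnormI g1 + sqnormI g2))%:E <=
   \int[mu]_(t in I) (((hilbert F t).1 ^+ 2 + (hilbert F t).2 ^+ 2)%:E))%E.
Proof.
move=> H1 H2; have [m1 i1 _] := H1; have [m2 i2 _] := H2.
pose G t := (pi^-1 * g1 t) ^+ 2 + (pi^-1 * g2 t) ^+ 2.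
have j1 := intg_sqrI m1 i1; have j2 := intg_sqrI m2 i2.
rewrite -(IntD j1 j2) -(IntZ _ (intgD j1 j2)) (EFin_Int (intgZ _ (intgD j1 j2))).
rewrite [leLHS](_ : _ = \int[mu]_(t in I) (G t)%:E)%E; last first.
  rewrite [RHS]integral_mkcond; apply: eq_integral => t _; rewrite patchE indicE /G.
  by case: (t \in I); rewrite ?mulr1 ?mulr0 ?addr0 ?mulr0// !exprMn exprVn -mulrDr.
apply: ae_le_integral.
- by apply: measurable_funD; apply: measurable_funX; apply: measurable_funM.
- by move=> t; rewrite addr_ge0 ?sqr_ge0.
- by move=> t; rewrite addr_ge0 ?sqr_ge0.
by apply: (aeS (aeI (hilbertRE H1) (hilbertRE H2))) => t [E1 E2]; rewrite /G E1 E2.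
Qed.

Lemma L2norm_sqr (F : cfun R) M :
  bsupp M (fun x => (F x).1 * \1_I x) -> bsupp M (fun x => (F x).2 * \1_I x) ->
  (\int[mu]_(t in I) (((F t).1 ^+ 2 + (F t).2 ^+ 2)%:E))%E =
  (Int (fun x => ((F x).1 * \1_I x) ^+ 2 + ((F x).2 * \1_I x) ^+ 2))%:E.
Proof.
move=> b1 b2; rewrite (EFin_Int (bsupp_intg (bsupp_add_sqr b1 b2))).
rewrite [LHS]integral_mkcond; apply: eq_integral => t _; rewrite patchE indicE.
by case: (t \in I); rewrite ?mulr1// !mulr0 expr0n addr0.
Qed.

Lemma simple_bsupp (phi : cfun R) : borel_simple phi -> exists M,
  bsupp M (fun x => (phi x).1 * \1_I x) /\ bsupp M (fun x => (phi x).2 * \1_I x).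
Proof.
move=> [[m1 m2] /finite_seqP[s sE]].
have sb (r : seq (R * R)) z : z \in r ->
    `|z.1| + `|z.2| <= \sum_(w <- r) (`|w.1| + `|w.2|).
  elim: r => [//|w r IH]; rewrite in_cons big_cons => /predU1P[<-|/IH h].
    by rewrite lerDl sumr_ge0// => i _; rewrite addr_ge0.
  by apply: (le_trans h); rewrite lerDr addr_ge0.
pose M := \sum_(w <- s) (`|w.1| + `|w.2|); exists M.
have pb x : I x -> `|(phi x).1| + `|(phi x).2| <= M.
  move=> Ix; apply: sb; have : (phi @` I) (phi x) by exists x.
  by rewrite /I sE.
have mc (k : R -> R) : measurable_fun I k -> meas (fun x => k x * \1_I x).
  move=> mk; have -> : (fun x => k x * \1_I x) = k \_ I.
    by apply/funext => x; rewrite patchE indicE; case: (_ \in _); rewrite ?mulr1 ?mulr0.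
  by apply/(measurable_restrictT _ _).1 => //; exact: measI.
split; split; try exact: mc.
- move=> x; have [Ix|nI] := pselect (I x).
    rewrite indicE mem_set// !mulr1; apply: le_trans (pb x Ix); by rewrite lerDl.
  by rewrite indicE memNset// !mulr0 normr0.
move=> x; have [Ix|nI] := pselect (I x).
  rewrite indicE mem_set// !mulr1; apply: le_trans (pb x Ix); by rewrite lerDr.
by rewrite indicE memNset// !mulr0 normr0.
Qed.

(** * The constant on the left-hand side *)

Lemma sin_le (x : R) : 0 < x -> sin x <= x.
Proof.
move=> x0; have [|c _] := @MVT R sin cos 0 x x0 (fun y _ => is_derive_sin y).
  by apply: continuous_subspaceT => y; exact: continuous_sin.
by rewrite sin0 !subr0 => ->; rewrite ler_piMl ?cos_le1// ltW.
Qed.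

(** sin (pi/4)^2 = 1/2, and sin x <= x gives 1/2 <= (pi/4)^2. *)
Lemma pi_sqr_ge8 : 8 <= pi ^+ 2 :> R.
Proof.
have p4 : 0 < pi / 4 :> R by rewrite divr_gt0 ?pi_gt0.
have s0 : 0 <= sin (pi / 4 : R).
  apply: sin_ge0_pi; rewrite (ltW p4) ler_pdivrMr// ler_peMr ?ler1n//.
  exact: pi_ge0.
have E : pi / 4 + pi / 4 = pi / 2 :> R by field.
have := cosD (pi / 4) (pi / 4 : R); rewrite E cos_pihalf => /esym.
have := cos2Dsin2 (pi / 4 : R); rewrite -!expr2.
have : sin (pi / 4) ^+ 2 <= (pi / 4) ^+ 2 :> R.
  by rewrite lerXn2r ?nnegrE ?(ltW p4)//; exact: sin_le.
rewrite exprMn; move: (pi ^+ 2) (sin _ ^+ 2) (cos _ ^+ 2) => P S C.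
have -> : (4^-1) ^+ 2 = 16^-1 :> R by field.
lra.
Qed.

(** With e^v >= 1 + v it suffices that (1 + v)^3 - 27 v / 4 = (v - 1/2)^2 (v + 4) is nonnegative. *)
Lemma expR_ge (v : R) : 0 <= v -> 27 / 4 * v <= expR (v + v + v).
Proof.
move=> v0; have h := expR_ge1Dx v; rewrite !expRD.
have h3 : (1 + v) * (1 + v) * (1 + v) <= expR v * expR v * expR v.
  by apply: ler_pM => //; [|rewrite addr_ge0|apply: ler_pM]; rewrite ?mulr_ge0 ?addr_ge0.
apply: le_trans h3; have := mulr_ge0 (sqr_ge0 (v - 2^-1)) (addr_ge0 v0 (ler0n R 4)).
lra.
Qed.

(** With E = e^(pi l / 2) the claim is 4 l <= (4 pi / 9) (E + 1/E). Already (4 pi / 9) E suffices,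
    since E >= 9 pi l / 8 makes it at least pi^2 l / 2, and pi^2 >= 8. *)
Lemma kernel_le (l : R) : 0 <= l ->
  4 * l / (expR (pi * l) + 1) <= 8 / 9 * exponential_pdf (pi / 2) l.
Proof.
move=> l0; have pi0 := pi_gt0 R; rewrite exponential_pdfE//.
have pn : (pi : R) != 0 by rewrite gt_eqF.
pose v : R := pi * l / 6; have v0 : 0 <= v by rewrite divr_ge0 ?mulr_ge0 ?(ltW pi0).
have h := expR_ge v0; set E := expR (v + v + v) in h.
have E0 : 0 < E := expR_gt0 _.
have -> : pi * l = (v + v + v) + (v + v + v) by rewrite /v; field.
have -> : - (pi / 2) * l = - (v + v + v) by rewrite /v; field.
rewrite expRD expRN -/E.
have -> : 8 / 9 * (pi / 2 / E) = (4 / 9 * pi) / E by field; rewrite gt_eqF.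
rewrite ler_pdivrMr; last by rewrite ltr_pwDr ?mulr_ge0 ?(ltW E0).
have hl : 9 / 8 * pi * l <= E.
  by apply: le_trans h; rewrite /v le_eqVlt; apply/orP; left; apply/eqP; field.
have h4 : 4 * l <= 4 / 9 * pi * E.
  have p8 := pi_sqr_ge8; have : 4 / 9 * pi * (9 / 8 * pi * l) <= 4 / 9 * pi * E.
    by apply: ler_wpM2l => //; apply: mulr_ge0 => //; exact: ltW.
  apply: le_trans; have -> : 4 / 9 * pi * (9 / 8 * pi * l) = pi ^+ 2 * l / 2 by field.
  have := ler_wpM2r l0 p8; lra.
apply: (le_trans h4); have -> : 4 / 9 * pi / E * (E * E + 1) = 4 / 9 * pi * E + 4 / 9 * pi / E.
  by field; rewrite gt_eqF.
by rewrite lerDl divr_ge0 ?(ltW E0)// mulr_ge0// ltW.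
Qed.

Lemma kernel_ge0 (l : R) : 0 <= l -> 0 <= 4 * l / (expR (pi * l) + 1).
Proof. by move=> l0; rewrite divr_ge0 ?mulr_ge0// addr_ge0// expR_ge0. Qed.

Lemma kernel_integral_le :
  (\int[mu]_(l in `[(0:R)%R, +oo[%classic) ((4 * l / (expR (pi * l) + 1))%:E) <= (8 / 9)%:E)%E.
Proof.
have r0 : 0 < pi / 2 :> R by rewrite divr_gt0 ?pi_gt0.
rewrite integral_mkcond.
apply: (@le_trans _ _ (\int[mu]_x (8 / 9 * exponential_pdf (pi / 2) x)%:E)%E).
  apply: ge0_le_integralT => x; rewrite patchE mem_setE in_itv/= andbT; case: ifP => //.
  - by rewrite lee_fin => /kernel_ge0.
  - by rewrite lee_fin => /kernel_le.
  by move=> _; rewrite lee_fin mulr_ge0// exponential_pdf_ge0// ltW.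
under eq_integral do rewrite EFinM.
rewrite ge0_integralZl//=.
- by rewrite integral_exponential_pdf// mule1.
- by apply/measurable_EFinP; exact: measurable_exponential_pdf.
by move=> x _; rewrite lee_fin exponential_pdf_ge0// ltW.
Qed.

(** Stated for squared norms; a real sign serves as theta, so that it multiplies both components
    alike. *)
Lemma unimodular_L2norm (phi : cfun R) : borel_simple phi ->
  exists2 th, unimodular th &
  ((8 / 9)%:E * \int[mu]_(t in I) (((phi t).1 ^+ 2 + (phi t).2 ^+ 2)%:E) <=
   \int[mu]_(t in I) (((hilbert (cmulf th phi) t).1 ^+ 2 + (hilbert (cmulf th phi) t).2 ^+ 2)%:E))%E.
Proof.
move=> /simple_bsupp[M [b1 b2]]; rewrite (L2norm_sqr b1 b2); set X := Int _.
have X0 : 0 <= X by apply: Int_ge0 => x; rewrite addr_ge0 ?sqr_ge0.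
have p0 : 0 < pi ^+ 2 :> R by rewrite exprn_gt0 ?pi_gt0.
(* The loss allowed is the ninth part that 8/9 leaves over. If X = 0 the claim is trivial, and 1 is
   only a positive placeholder. *)
pose e := if X == 0 then 1 else pi ^+ 2 * X / 9.
have e0 : 0 < e.
  rewrite /e; case: eqVneq => [//|Xn]; have Xp : 0 < X by rewrite lt_neqAle eq_sym Xn.
  by apply: divr_gt0 => //; exact: mulr_gt0.
have [th [g1 [g2 [[mth th1] H1 H2 h]]]] := unimodular_lower b1 b2 e0.
pose Th : cfun R := fun x => (th x, 0).
exists Th; first split; first split.
- exact: measurable_funTS.
- exact: measurable_cst.
- by exists set0; split=> // x; apply: contra_notP => _ _; rewrite /= th1 expr0n addr0.
have K1 : is_hilbert (fun x => (cmulf Th phi x).1 * \1_I x) g1.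
  have -> // : (fun x => (cmulf Th phi x).1 * \1_I x) = fun x => (phi x).1 * \1_I x * th x.
  by apply/funext => x; rewrite /cmulf /= mul0r subr0 -mulrA mulrC.
have K2 : is_hilbert (fun x => (cmulf Th phi x).2 * \1_I x) g2.
  have -> // : (fun x => (cmulf Th phi x).2 * \1_I x) = fun x => (phi x).2 * \1_I x * th x.
  by apply/funext => x; rewrite /cmulf /= mul0r addr0 -mulrA mulrC.
apply: le_trans (L2norm_hilbert K1 K2); rewrite -EFinM lee_fin.
have N0 : 0 <= sqnormI g1 + sqnormI g2.
  by rewrite addr_ge0// Int_ge0// => x; rewrite mulr_ge0 ?sqr_ge0 ?indicI_ge0.
rewrite [leRHS]mulrC ler_pdivlMr//; move: h; rewrite -/X /e; case: eqVneq => [-> _|_].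
  by rewrite mulr0 mul0r.
move: (pi ^+ 2) (sqnormI g1 + sqnormI g2) => p N; lra.
Qed.

End Transfer.

Theorem theorem5p2 (R : realType) (phi : cfun R) :
  borel_simple phi ->
  (((\int[lebesgue_measure]_(l in `[(0:R)%R, +oo[%classic)
        ((4 * l / (expR (pi * l) + 1))%:E)) `^ (2^-1)) * L2norm phi
   <= ereal_sup [set L2norm (hilbert (cmulf th phi)) | th in [set th | unimodular th]])%E.
Proof.
move=> phis; have [th uth le] := unimodular_L2norm phis.
have K0 : (0 <= \int[lebesgue_measure]_(l in `[(0:R)%R, +oo[%classic)
    ((4 * l / (expR (pi * l) + 1))%:E))%E.
  by apply: integral_ge0 => l; rewrite /= in_itv/= andbT lee_fin; exact: kernel_ge0.
have sq0 (F : cfun R) : (0 <= \int[lebesgue_measure]_(x in @I11 R)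
    (((F x).1 ^+ 2 + (F x).2 ^+ 2)%:E))%E.
  by apply: integral_ge0 => x _; rewrite lee_fin addr_ge0 ?sqr_ge0.
apply: (@le_trans _ _ (L2norm (hilbert (cmulf th phi)))); last first.
  by apply: ereal_sup_ubound; exists th.
move: (hilbert _) le => H le.
rewrite /L2norm -poweRM//; apply: gt0_ler_poweR => //; rewrite ?in_itv/= ?leey ?andbT//.
- by rewrite mule_ge0.
by apply: le_trans le; apply: lee_wpmul2r => //; exact: kernel_integral_le.
Qed.
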